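(* Let $P$ be a regular convex $n$-gon with vertices $A_0,\dots,A_{n-1}$ (indices mod $n$), let $l$ be the line perpendicular to the plane of $P$ through its center, and let $O_0\ne O_1$ be points of $l$ not lying in the plane of $P$. Let $\mathcal D$ be the dipyramid with vertices $O_0,O_1$, and let $f\colon\mathcal D\to\mathbb{R}$ be convex on every simplex $O_0O_1A_kA_{k+1}$, $k=0,\dots,n-1$. For $i=0,1$ let $\eta_i$ be the angle between $l$ and the plane of a side $\operatorname{conv}\{O_i,A_k,A_{k+1}\}$ of $\mathcal U_{O_i}$. For $0<s<1$ let $O_s=(1-s)O_0+sO_1$, and let $\mathcal D_s^0$ and $\mathcal D_s^1$ be the dipyramids with vertices $O_0,O_s$ and $O_1,O_s$ respectively. Then for all $0<s<1$: $$\operatorname{Avg}(f,\mathcal D)\le\tfrac14f(O_s)+\tfrac34\left(s\operatorname{Avg}(f,\mathcal U_{O_0})+(1-s)\operatorname{Avg}(f,\mathcal U_{O_1})\right),$$ $$s\operatorname{Avg}(f,h_{O_s}^{3/4}(\mathcal U_{O_0}))+(1-s)\operatorname{Avg}(f,h_{O_s}^{3/4}(\mathcal U_{O_1}))\le\operatorname{Avg}(f,\mathcal D),$$ $$\operatorname{Avg}(f,\partial h_{O_s}^{3/4}(\mathcal D))\le\frac{\sin\eta_1}{\sin\eta_0+\sin\eta_1}\operatorname{Avg}(f,\mathcal D_s^0)+\frac{\sin\eta_0}{\sin\eta_0+\sin\eta_1}\operatorname{Avg}(f,\mathcal D_s^1).$$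
   Context: For a point $X\in l$, the Chinese umbrella with vertex $X$ is $\mathcal U_X=\bigcup_{k=0}^{n-1}\operatorname{conv}\{X,A_k,A_{k+1}\}$. The dipyramid with vertices $X,Y\in l$ is the body bounded by $\mathcal U_X$ and $\mathcal U_Y$, i.e. $\bigcup_{k=0}^{n-1}\operatorname{conv}\{X,Y,A_k,A_{k+1}\}$ (it need not be convex). Averages over dipyramids are with respect to volume, and averages over umbrellas and boundary surfaces are with respect to surface area. $h_{\mathbf a}^\lambda(\mathbf x)=\mathbf a+\lambda(\mathbf x-\mathbf a)$. *)

(* Defs.v *)
From HB Require Import structures.
From mathcomp Require Import all_boot all_order all_algebra.
From mathcomp Require Import all_classical all_reals all_analysis.
Set Implicit Arguments. Unset Strict Implicit. Unset Printing Implicit Defensive.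
Import Order.TTheory GRing.Theory Num.Theory.
Import numFieldNormedType.Exports.
Local Open Scope classical_set_scope.
Local Open Scope ring_scope.

Section Geometry.
Variable R : realType.
Notation vec := 'rV[R]_3.

Definition dot (u v : vec) : R := \sum_(i < 3) u ord0 i * v ord0 i.
Definition vnorm (u : vec) : R := Num.sqrt (dot u u).
Definition cross (u v : vec) : vec :=
  \row_(j < 3) (u ord0 (inord ((j + 1) %% 3)) * v ord0 (inord ((j + 2) %% 3))
              - u ord0 (inord ((j + 2) %% 3)) * v ord0 (inord ((j + 1) %% 3))).

Definition homothety (a : vec) (lam : R) (x : vec) : vec := a + lam *: (x - a).

Definition tri_area (p q r : vec) : R := vnorm (cross (q - p) (r - p)) / 2.
Definition tet_volume (p q r s : vec) : R :=
  `|dot (q - p) (cross (r - p) (s - p))| / 6.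

(* Average of f over the triangle conv{p,q,r} w.r.t. surface area,
   computed via the affine parametrization of the triangle by the
   standard 2-simplex (change of variables: the Jacobian is constant). *)
Definition tri_avg (f : vec -> R) (p q r : vec) : R :=
  2 * \int[lebesgue_measure]_(u in `[0, 1]%classic)
        \int[lebesgue_measure]_(v in `[0, 1 - u]%classic)
          f (p + u *: (q - p) + v *: (r - p)).

(* Average of f over the tetrahedron conv{p,q,r,s} w.r.t. volume,
   via the affine parametrization by the standard 3-simplex. *)
Definition tet_avg (f : vec -> R) (p q r s : vec) : R :=
  6 * \int[lebesgue_measure]_(u in `[0, 1]%classic)
        \int[lebesgue_measure]_(v in `[0, 1 - u]%classic)
          \int[lebesgue_measure]_(w in `[0, 1 - u - v]%classic)
            f (p + u *: (q - p) + v *: (r - p) + w *: (s - p)).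

(* A polyhedral surface given as a list of triangles (pairwise meeting only
   in sets of zero area), and a polyhedral body given as a list of tetrahedra
   (with pairwise disjoint interiors).  Averages are area/volume weighted. *)
Definition surf_avg (f : vec -> R) (T : seq (vec * vec * vec)) : R :=
  (\sum_(t <- T) tri_area t.1.1 t.1.2 t.2 * tri_avg f t.1.1 t.1.2 t.2)
  / (\sum_(t <- T) tri_area t.1.1 t.1.2 t.2).
Definition body_avg (f : vec -> R) (T : seq (vec * vec * vec * vec)) : R :=
  (\sum_(t <- T) tet_volume t.1.1.1 t.1.1.2 t.1.2 t.2 * tet_avg f t.1.1.1 t.1.1.2 t.1.2 t.2)
  / (\sum_(t <- T) tet_volume t.1.1.1 t.1.1.2 t.1.2 t.2).

(* Chinese umbrella with vertex X over the polygon A_0 .. A_{n-1} (indices mod n,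
   A is given as an n-periodic function nat -> vec): triangles conv{X,A_k,A_{k+1}} *)
Definition umbrella (n : nat) (A : nat -> vec) (X : vec) : seq (vec * vec * vec) :=
  [seq (X, A k, A k.+1) | k <- iota 0 n].
Definition dipyramid (n : nat) (A : nat -> vec) (X Y : vec) : seq (vec * vec * vec * vec) :=
  [seq (X, Y, A k, A k.+1) | k <- iota 0 n].
Definition dipyramid_boundary (n : nat) (A : nat -> vec) (X Y : vec) :=
  umbrella n A X ++ umbrella n A Y.

Definition in_tet (a b c d x : vec) : Prop :=
  exists l0 l1 l2 l3 : R, [/\ 0 <= l0, 0 <= l1, 0 <= l2 & 0 <= l3] /\
    l0 + l1 + l2 + l3 = 1 /\ x = l0 *: a + l1 *: b + l2 *: c + l3 *: d.

Definition convex_on_tet (f : vec -> R) (a b c d : vec) : Prop :=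
  forall x y (t : R), in_tet a b c d x -> in_tet a b c d y -> 0 <= t <= 1 ->
    f ((1 - t) *: x + t *: y) <= (1 - t) * f x + t * f y.

Definition line_plane_angle (dir p q r : vec) : R :=
  let nv := cross (q - p) (r - p) in
  asin (`|dot dir nv| / (vnorm dir * vnorm nv)).

Definition reg_vertex (n : nat) (C e1 e2 : vec) (rad th : R) (k : nat) : vec :=
  C + rad *: (cos (th + 2 * pi * k%:R / n%:R) *: e1
             + sin (th + 2 * pi * k%:R / n%:R) *: e2).

End Geometry.

(* Main.v *)
Require Import Defs.
From HB Require Import structures.
From mathcomp Require Import all_boot all_order all_algebra.
From mathcomp Require Import all_classical all_reals all_analysis measurable_realfun.
From mathcomp Require Import ring lra.
Set Implicit Arguments. Unset Strict Implicit. Unset Printing Implicit Defensive.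
Import Order.TTheory GRing.Theory Num.Theory.
Import numFieldNormedType.Exports.
Local Open Scope classical_set_scope.
Local Open Scope ring_scope.

(** All the simplices of a dipyramid have the same volume and all the sides of an
umbrella the same area, so every average is a plain mean over k and each
inequality reduces to one tetrahedron with vertices p, q, r, t.  Slicing it parallel
to the face p r t, at height u towards q, writes its average as
3 times the integral of (1 - u)^2 g(u), where g(u) is the average of f over the slice.
Since g is convex on [0, 1], the chord bound g(u) <= (1 - u) g(0) + u g(1) gives
Avg(f, pqrt) <= f(q)/4 + (3/4) Avg(f, prt), and the supporting line at u = 1/4, the
barycentre of the weight, gives g(1/4) <= Avg(f, pqrt); g(1/4) is the average over the
image of p r t under the homothety with centre q and ratio 3/4.  These are applied with
q = O_s to the two halves of each simplex, Avg(f, O_0 O_1 A B) being the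
combination of the averages over O_0 O_s A B and O_1 O_s A B with weights s and 1 - s.
The latter needs Fubini's theorem: a convex function on a triangle is measurable
because its sublevel sets inside the open triangle are open. *)

(** * Integrals over intervals *)

Section BoundedMeasurable.
Context {d} {T : measurableType d} {R : realType}.
Implicit Types (D : set T) (f g : T -> R).

(** Boundedness makes the class closed under products and contained in the integrable functions on
    every set of finite measure, so integrability is never proved by hand. *)
Definition bdd_mfun D f :=
  measurable_fun D f /\ exists M : R, forall x, D x -> `|f x| <= M.

Lemma bdd_mfunD D f g : bdd_mfun D f -> bdd_mfun D g ->
  bdd_mfun D (fun x => f x + g x).
Proof.
move=> [mf [M fM]] [mg [N gN]]; split; first exact: measurable_funD.
by exists (M + N) => x Dx; rewrite (le_trans (ler_normD _ _))// lerD ?fM ?gN.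
Qed.

Lemma bdd_mfunM D f g : bdd_mfun D f -> bdd_mfun D g ->
  bdd_mfun D (fun x => f x * g x).
Proof.
move=> [mf [M fM]] [mg [N gN]]; split; first exact: measurable_funM.
by exists (M * N) => x Dx; rewrite normrM ler_pM ?fM ?gN.
Qed.

Lemma bdd_mfun_cst D (c : R) : bdd_mfun D (fun=> c).
Proof. by split; [exact: measurable_cst | exists `|c|]. Qed.

Lemma bdd_mfunS D E f : measurable E -> D `<=` E -> bdd_mfun E f -> bdd_mfun D f.
Proof.
move=> mE DE [mf [M fM]]; split; first exact: (measurable_funS mE DE).
by exists M => x /DE; exact: fM.
Qed.

Lemma eq_bdd_mfun D f g : (forall x, D x -> f x = g x) ->
  bdd_mfun D f -> bdd_mfun D g.
Proof.
move=> fg [mf [M fM]]; split.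
  by apply: (eq_measurable_fun f) => // x; rewrite inE => /fg.
by exists M => x Dx; rewrite -fg// fM.
Qed.

Lemma bdd_mfun_integrable (mu : {measure set T -> \bar R}) D f :
  measurable D -> (mu D < +oo)%E -> bdd_mfun D f ->
  mu.-integrable D (EFin \o f).
Proof.
move=> mD Doo [mf [M fM]]; apply: measurable_bounded_integrable => //.
exists M; split; first exact: num_real.
by move=> N MN x Dx; exact: le_trans (fM x Dx) (ltW MN).
Qed.

End BoundedMeasurable.

Section Interval.
Context {R : realType}.
Notation mu := (@lebesgue_measure R).
Implicit Types (a b m : R) (f g : R -> R).

Lemma mu_itvcc_lty a b : (mu `[a, b]%classic < +oo)%E.
Proof. by rewrite lebesgue_measure_itv/=; case: ifP => // _; rewrite -EFinB ltry. Qed.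

Lemma itv_integrable a b f : bdd_mfun `[a, b]%classic f ->
  mu.-integrable `[a, b]%classic (EFin \o f).
Proof. by move=> bf; apply: bdd_mfun_integrable => //; exact: mu_itvcc_lty. Qed.

Lemma bdd_mfun_id a b : bdd_mfun `[a, b]%classic (fun x : R => x).
Proof.
split; first exact: measurable_id.
exists (`|a| + `|b|) => x /=; rewrite in_itv/= => /andP[ax xb].
have := ler_norm b; have := ler_norm (- a); rewrite normrN.
by rewrite ler_norml; have := normr_ge0 a; have := normr_ge0 b; lra.
Qed.

Lemma itv_intD a b f g : bdd_mfun `[a, b]%classic f -> bdd_mfun `[a, b]%classic g ->
  \int[mu]_(x in `[a, b]%classic) (f x + g x) =
  \int[mu]_(x in `[a, b]%classic) f x + \int[mu]_(x in `[a, b]%classic) g x.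
Proof. by move=> bf bg; rewrite RintegralD//; exact: itv_integrable. Qed.

Lemma itv_intZ a b c f : bdd_mfun `[a, b]%classic f ->
  \int[mu]_(x in `[a, b]%classic) (c * f x) =
  c * \int[mu]_(x in `[a, b]%classic) f x.
Proof. by move=> bf; rewrite RintegralZl//; exact: itv_integrable. Qed.

Lemma le_itv_int a b f g : bdd_mfun `[a, b]%classic f -> bdd_mfun `[a, b]%classic g ->
  (forall x, a <= x <= b -> f x <= g x) ->
  \int[mu]_(x in `[a, b]%classic) f x <= \int[mu]_(x in `[a, b]%classic) g x.
Proof.
move=> bf bg fg; by apply: le_Rintegral => //; exact: itv_integrable.
Qed.

Lemma eq_itv_int a b f g : (forall x, a <= x <= b -> f x = g x) ->
  \int[mu]_(x in `[a, b]%classic) f x = \int[mu]_(x in `[a, b]%classic) g x.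
Proof. by move=> fg; apply: eq_Rintegral => x; rewrite inE/= in_itv/=; exact: fg. Qed.

(** By uniqueness of Lebesgue measure: [|a|] times the image of [mu] under [x => a * x + b] gives
    each half-open interval its length. *)
Lemma lebesgue_measure_affine a b (A : set (measurableTypeR R)) : a != 0 ->
  measurable A ->
  mu A = (`|a|%:E * mu ((fun x => (a * x + b)%R) @^-1` A))%E.
Proof.
move=> a0 mA.
have mphi : measurable_fun [set: measurableTypeR R]
    (fun x : measurableTypeR R => a * x + b : measurableTypeR R).
  by apply: measurable_funD => //; exact: measurable_funM.
have [nu nuE] : exists nu : {measure set (measurableTypeR R) -> \bar R},
    forall B, nu B = mu ((fun x => (a * x + b)%R) @^-1` B).
  by unshelve eexists (pushforward mu _); [|exact: mphi|].
pose rho := mscale (NngNum (normr_ge0 a)) nu.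
rewrite -nuE -[RHS]/(rho A).
apply: lebesgue_measure_unique => // _ [[x y] /= _ <-].
rewrite /rho /mscale/= nuE.
have [agt0|alt0|a00] := ltgtP 0 a; last by rewrite -a00 eqxx in a0.
- rewrite (_ : _ @^-1` _ = `]((x - b) / a), ((y - b) / a)]%classic); last first.
    by apply/seteqP; split => z /=; rewrite !in_itv/= ltr_pdivrMr// ler_pdivlMr// =>
      /andP[h1 h2]; apply/andP; split; lra.
  rewrite !lebesgue_measure_itv/= !lte_fin ltr_pM2r ?invr_gt0// ltrD2r.
  case: ifPn => _; last by rewrite mule0.
  by rewrite -!EFinB -EFinM gtr0_norm//; congr EFin; field; lra.
(* A negative slope reverses the interval and moves its closed end to the left, which leaves the
   length unchanged. *)
- rewrite (_ : _ @^-1` _ = `[((y - b) / a), ((x - b) / a)[%classic); last first.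
    by apply/seteqP; split => z /=; rewrite !in_itv/= ler_ndivrMr// ltr_ndivlMr// =>
      /andP[h1 h2]; apply/andP; split; lra.
  rewrite !lebesgue_measure_itv/= !lte_fin ltr_nM2r ?invr_lt0// ltrD2r.
  case: ifPn => _; last by rewrite mule0.
  by rewrite -!EFinB -EFinM ltr0_norm//; congr EFin; field; lra.
Qed.

Lemma ge0_integral_affine a b (D : set R) (f : R -> \bar R) : a != 0 ->
  measurable D -> measurable_fun D f -> (forall x, D x -> 0 <= f x)%E ->
  (\int[mu]_(x in D) f x =
   `|a|%:E * \int[mu]_(x in (fun x => (a * x + b)%R) @^-1` D) f (a * x + b)%R)%E.
Proof.
move=> a0 mD mf f0.
pose phi : measurableTypeR R -> measurableTypeR R := fun x => a * x + b.
have mphi : measurable_fun [set: measurableTypeR R] phi.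
  by apply: measurable_funD => //; exact: measurable_funM.
have [nu [nuE nuI]] : exists nu : {measure set (measurableTypeR R) -> \bar R},
    (forall B, nu B = mu (phi @^-1` B)) /\
    (\int[nu]_(x in D) f x = \int[mu]_(x in phi @^-1` D) (f \o phi) x)%E.
  unshelve eexists (pushforward mu phi); first exact: mphi.
  split=> //; apply: ge0_integral_pushforward => //.
  by move=> y; rewrite inE; exact: f0.
rewrite (eq_measure_integral (mscale (NngNum (normr_ge0 a)) nu)); last first.
  move=> A mA _; have := lebesgue_measure_affine b a0 mA; rewrite -nuE => E; exact: E.
rewrite ge0_integral_mscale//=; congr (_ * _)%E.
by rewrite nuI.
Qed.

Lemma Rintegral_affine a b (D : set R) f : a != 0 -> measurable D ->
  measurable_fun D f ->
  \int[mu]_(x in D) f x =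
  `|a| * \int[mu]_(x in (fun x => a * x + b) @^-1` D) f (a * x + b).
Proof.
move=> a0 mD mf.
have a0' : 0 < `|a| by rewrite normr_gt0.
have mEf : measurable_fun D (EFin \o f) by exact/measurable_EFinP.
rewrite /Rintegral integralE [in RHS]integralE.
rewrite (@ge0_integral_affine a b D)//; last exact: measurable_funepos.
rewrite (@ge0_integral_affine a b D _ a0 mD (measurable_funeneg mEf))//.
set p := (X in (_ * X - _)%E); set q := (X in (_ - _ * X)%E).
rewrite (_ : (\int[mu]_(x in _) ((fun x => (f (a * x + b)%R)%:E)^\+ x))%E = p); last by apply: eq_integral => x _; rewrite !funeposE.
rewrite (_ : (\int[mu]_(x in _) ((fun x => (f (a * x + b)%R)%:E)^\- x))%E = q); last by apply: eq_integral => x _; rewrite !funenegE.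
have p0 : (0 <= p)%E by exact: integral_ge0.
have q0 : (0 <= q)%E by exact: integral_ge0.
(* If the integral of the positive or of the negative part is infinite, both sides are 0, the value
   of [fine] at an infinity. *)
case: p q p0 q0 => [p| |] [q| |]// p0 q0.
- by rewrite -!EFinM -!EFinB /= mulrBr.
- by rewrite gt0_muley ?lte_fin//= mulr0.
- by rewrite gt0_muley ?lte_fin//= mulr0.
- by rewrite gt0_muley ?lte_fin//= mulr0.
Qed.

Lemma itv_int_scale m f : 0 <= m -> bdd_mfun `[0, m]%classic f ->
  \int[mu]_(x in `[0, m]%classic) f x = m * \int[mu]_(x in `[0, 1]%classic) f (m * x).
Proof.
rewrite le_eqVlt => /predU1P[<-|m0] [mf _].
  by rewrite set_itv1 Rintegral_set1 mul0r.
rewrite (@Rintegral_affine m 0)// ?gt_eqF// gtr0_norm//.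
rewrite (_ : _ @^-1` _ = `[0, 1]%classic); last first.
  by apply/seteqP; split => x /=; rewrite !in_itv/= => /andP[h1 h2]; apply/andP; split; nra.
by congr (_ * _); apply: eq_itv_int => x _; rewrite addr0.
Qed.

(** The second piece is reflected by [x => m - x], so that each piece is measured from its own end,
    as the two halves of a simplex are from [O0] and [O1]. *)
Lemma itv_int_split m c f : 0 <= c <= m -> bdd_mfun `[0, m]%classic f ->
  \int[mu]_(x in `[0, m]%classic) f x =
  \int[mu]_(x in `[0, c]%classic) f x +
  \int[mu]_(x in `[0, m - c]%classic) f (m - x).
Proof.
move=> /andP[c0 cm] bf.
have i1 := itv_integrable bf.
have bfc : bdd_mfun `[c, m]%classic f.
  by apply: bdd_mfunS bf => // x /=; rewrite !in_itv/= => /andP[h ->]; rewrite (le_trans c0).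
have := @Rintegral_itvB _ f (BLeft 0) (BRight m) c i1.
rewrite !bnd_simp => /(_ c0 cm) E; rewrite [RHS]addrC; apply/eqP; rewrite -subr_eq; apply/eqP.
rewrite E Rintegral_itv_obnd_cbnd; last first.
  by apply: integrableS (itv_integrable bfc) => // x /=; rewrite !in_itv/= => /andP[/ltW -> ->].
rewrite (@Rintegral_affine (-1) m)//; last by case: bfc.
rewrite normrN1 mul1r (_ : _ @^-1` _ = `[0, m - c]%classic); last first.
  by apply/seteqP; split => x /=; rewrite !in_itv/= => /andP[h1 h2]; apply/andP; split; lra.
by apply: eq_itv_int => x _; congr f; ring.
Qed.

Lemma bdd_mfun_affine a b p q r t f :
  (forall x, p <= x <= q -> r <= a * x + b <= t) ->
  bdd_mfun `[r, t]%classic f -> bdd_mfun `[p, q]%classic (fun x => f (a * x + b)).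
Proof.
move=> h [mf [M fM]]; split; last first.
  by exists M => x /=; rewrite in_itv/= => /h xrt; apply: fM; rewrite /= in_itv/=.
apply: (@measurable_comp _ _ _ _ _ _ `[r, t]%classic f _ (fun x => a * x + b)) => //.
  by move=> _ [x /=] + <-; rewrite !in_itv/=; exact: h.
by apply: measurable_funD => //; exact: measurable_funM.
Qed.

End Interval.

(** * Convex functions of one and two variables *)

Section Convex1.
Context {R : realType}.
Notation mu := (@lebesgue_measure R).
Implicit Types (m : R) (g : R -> R).

Definition convex1 m g := forall x y t,
  0 <= x <= m -> 0 <= y <= m -> 0 <= t <= 1 ->
  g ((1 - t) * x + t * y) <= (1 - t) * g x + t * g y.

Lemma measurable_fun_sublevel d (T : measurableType d) (D : set T) (f : T -> R) :
  (forall a, measurable (D `&` [set x | f x < a])) -> measurable_fun D f.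
Proof.
move=> H mD; apply: (measurability _ (RGenInftyO.measurableE R)) => //.
by move=> _ [_ [a ->] <-]; rewrite (_ : _ @^-1` _ = [set x | f x < a])//;
  apply/seteqP; split => x /=; rewrite in_itv.
Qed.

(** Sublevel sets are intervals, which gives measurability even when [g] jumps at an end. The chord
    bounds [g] from above, and the midpoint inequality for [x] and [m - x] turns this into a lower
    bound. *)
Lemma convex1_bdd_mfun m g : convex1 m g -> bdd_mfun `[0, m]%classic g.
Proof.
move=> cg; split.
  apply: measurable_fun_sublevel => a; apply: is_interval_measurable.
  move=> x y /= [+ gx] [+ gy] z /andP[]; rewrite !in_itv/= => /andP[x0 xm] /andP[y0 ym].
  rewrite (le_eqVlt x) => /orP[/eqP<- _|xz]; first by rewrite x0.
  rewrite (le_eqVlt z y) => /orP[/eqP->|zy]; first by rewrite y0.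
  have xy : 0 < y - x by lra.
  split; first by apply/andP; split; lra.
  pose t := (z - x) / (y - x).
  have t0 : 0 < t by rewrite divr_gt0//; lra.
  have t1 : t < 1 by rewrite ltr_pdivrMr//; lra.
  have -> : z = (1 - t) * x + t * y by rewrite /t; field; lra.
  apply: le_lt_trans (cg x y t _ _ _) _; [by apply/andP; split; lra..|].
  by nra.
exists (`|g 0| + `|g m| + 2 * `|g (m / 2)|) => x /=; rewrite in_itv/= => /andP[x0 xm].
have [m0|m0] := leP m 0.
  have -> : x = 0 by lra.
  by have := normr_ge0 (g m); have := normr_ge0 (g (m / 2)); lra.
have up (y : R) : 0 <= y <= m -> g y <= `|g 0| + `|g m|.
  move=> /andP[y0 ym].
  have t0 : 0 <= y / m by rewrite divr_ge0// ltW.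
  have t1 : y / m <= 1 by rewrite ler_pdivrMr// mul1r.
  have := cg 0 m (y / m); rewrite lexx (ltW m0) lexx t0 t1 => /(_ isT isT isT).
  rewrite mulr0 add0r divfK ?gt_eqF//.
  by have := ler_norm (g 0); have := ler_norm (g m); have := normr_ge0 (g 0);
    have := normr_ge0 (g m); nra.
have lo : 2 * g (m / 2) - g (m - x) <= g x.
  have := cg x (m - x) 2^-1.
  have -> : (1 - 2^-1) * x + 2^-1 * (m - x) = m / 2 by field.
  have h1 : 0 <= x <= m by rewrite x0.
  have h2 : 0 <= m - x <= m by apply/andP; split; lra.
  have h3 : 0 <= (2^-1 : R) <= 1 by apply/andP; split; lra.
  by move=> /(_ h1 h2 h3); lra.
have u1 : g x <= `|g 0| + `|g m| by apply: up; rewrite x0.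
have u2 : g (m - x) <= `|g 0| + `|g m| by apply: up; apply/andP; split; lra.
have := ler_norm (- g (m / 2)); rewrite normrN => u3.
by rewrite ler_norml; apply/andP; split; have := normr_ge0 (g (m / 2)); lra.
Qed.

(** Serves for sections of functions controlled only on an open triangle: two extra points spoil
    neither property. The bound uses [|M|] since [M] may be negative when the open interval is
    empty. *)
Lemma bdd_mfun_itvoo_cc m g : bdd_mfun `]0, m[%classic g -> bdd_mfun `[0, m]%classic g.
Proof.
move=> [mg [M gM]]; split.
  by apply/measurable_fun_itv_obnd_cbndP/measurable_fun_itv_bndo_bndcP.
exists (`|M| + `|g 0| + `|g m|) => x /=; rewrite in_itv/= => /andP[].
have := normr_ge0 M; have := normr_ge0 (g 0); have := normr_ge0 (g m) => gm g0 M0.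
rewrite (le_eqVlt 0 x) => /predU1P[<- _|x0]; first by lra.
rewrite (le_eqVlt x m) => /predU1P[->|xm]; first by lra.
have := gM x; rewrite /= in_itv/= x0 xm => /(_ isT).
by have := ler_norm M; lra.
Qed.

Lemma itv_int_oo m g : bdd_mfun `]0, m[%classic g ->
  \int[mu]_(x in `[0, m]%classic) g x = \int[mu]_(x in `]0, m[%classic) g x.
Proof. by move=> [mg _]; rewrite /Rintegral integral_itv_bndoo//; exact/measurable_EFinP. Qed.

End Convex1.

(** * Measurability and boundedness of convex functions on a triangle *)

Section ConvexPlane.
Context {R : realType}.
Implicit Types (S : set (R * R)) (m : R) (k : R -> R -> R).

(** The point is reached in two steps: interpolate horizontally on the bottom and top edges, then
    vertically between the two points found. *)
Lemma convex_set_box S (a b c d x y : R) :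
  (forall p q t, S p -> S q -> 0 <= t <= 1 ->
     S ((1 - t) * p.1 + t * q.1, (1 - t) * p.2 + t * q.2)) ->
  S (a, c) -> S (a, d) -> S (b, c) -> S (b, d) ->
  a < x < b -> c < y < d -> S (x, y).
Proof.
move=> cS Sac Sad Sbc Sbd /andP[ax xb] /andP[cy yd].
pose s := (x - a) / (b - a); pose t := (y - c) / (d - c).
have s01 : 0 <= s <= 1.
  by rewrite /s divr_ge0 ?ler_pdivrMr//=; lra.
have t01 : 0 <= t <= 1.
  by rewrite /t divr_ge0 ?ler_pdivrMr//=; lra.
have := cS _ _ t (cS _ _ s Sac Sbc s01) (cS _ _ s Sad Sbd s01) t01 => /=.
congr S; congr (_, _); rewrite /s /t; field; lra.
Qed.

(* An open convex set is the union of the open rational boxes whose corners it contains. *)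
Lemma convex_radially_open_measurable S :
  (forall p q t, S p -> S q -> 0 <= t <= 1 ->
     S ((1 - t) * p.1 + t * q.1, (1 - t) * p.2 + t * q.2)) ->
  (forall p (d1 d2 : R), S p ->
     exists2 r : R, 0 < r & forall t, 0 <= t <= r -> S (p.1 + t * d1, p.2 + t * d2)) ->
  measurable S.
Proof.
move=> cS oS.
pose box (q : (rat * rat) * (rat * rat)) : set (R * R) :=
  `]ratr q.1.1, ratr q.1.2[%classic `*` `]ratr q.2.1, ratr q.2.2[%classic.
pose corners (q : (rat * rat) * (rat * rat)) :=
  [/\ S (ratr q.1.1, ratr q.2.1), S (ratr q.1.1, ratr q.2.2),
      S (ratr q.1.2, ratr q.2.1) & S (ratr q.1.2, ratr q.2.2)].
rewrite (_ : S = \bigcup_q (if `[< corners q >] then box q else set0)).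
  apply: countable_bigcupT_measurable => [|q]; first exact: countableP.
  case: ifP => _; last exact: measurable0.
  by apply: measurableX; exact: measurable_itv.
apply/seteqP; split => [[x y] Sxy|[x y] [q _]]; last first.
  case: asboolP => // -[h1 h2 h3 h4] /= [/=]; rewrite !in_itv/= => hx hy.
  exact: (convex_set_box cS h1 h2 h3 h4).
(* Moving along the four diagonals yields the corners of a square about [(x, y)], which lies in [S]
   by convexity. A rational box around the point is then chosen inside this square. *)
have [r1 r10 h1] := oS _ 1 1 Sxy; have [r2 r20 h2] := oS _ 1 (-1) Sxy.
have [r3 r30 h3] := oS _ (-1) 1 Sxy; have [r4 r40 h4] := oS _ (-1) (-1) Sxy.
pose r := Num.min (Num.min r1 r2) (Num.min r3 r4).
have r0 : 0 < r by rewrite !lt_min r10 r20 r30 r40.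
have [e1 e2 e3 e4] : [/\ r <= r1, r <= r2, r <= r3 & r <= r4].
  by rewrite /r !ge_min !lexx !orbT.
have rr s : r <= s -> 0 <= r <= s by rewrite (ltW r0).
have := h4 _ (rr _ e4); have := h3 _ (rr _ e3).
have := h2 _ (rr _ e2); have := h1 _ (rr _ e1).
rewrite /= !mulrN1 !mulr1 => k1 k2 k3 k4.
have inS (u v : R) : x - r < u < x + r -> y - r < v < y + r -> S (u, v).
  exact: (convex_set_box cS k4 k3 k2 k1).
have [xm xp ym yp] : [/\ x - r < x, x < x + r, y - r < y & y < y + r] by split; lra.
have [a] := @rat_in_itvoo R (x - r) x xm; rewrite in_itv/= => /andP[a1 a2].
have [b] := @rat_in_itvoo R x (x + r) xp; rewrite in_itv/= => /andP[b1 b2].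
have [c] := @rat_in_itvoo R (y - r) y ym; rewrite in_itv/= => /andP[c1 c2].
have [d] := @rat_in_itvoo R y (y + r) yp; rewrite in_itv/= => /andP[d1 d2].
exists ((a, b), (c, d)) => //.
case: asboolP => [_|[]].
  by split; rewrite /= in_itv/= ?a2 ?b1 ?c2 ?d1 ?a1 ?b2 ?c1 ?d2; apply/andP; split.
have Ha : x - r < ratr a < x + r by rewrite a1 (lt_trans a2 xp).
have Hb : x - r < ratr b < x + r by rewrite (lt_trans xm b1) b2.
have Hc : y - r < ratr c < y + r by rewrite c1 (lt_trans c2 yp).
have Hd : y - r < ratr d < y + r by rewrite (lt_trans ym d1) d2.
by split; exact: inS.
Qed.

Definition convex2 m k := forall x1 y1 x2 y2 t,
  0 <= x1 -> 0 <= y1 -> x1 + y1 <= m -> 0 <= x2 -> 0 <= y2 -> x2 + y2 <= m ->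
  0 <= t <= 1 ->
  k ((1 - t) * x1 + t * x2) ((1 - t) * y1 + t * y2)
    <= (1 - t) * k x1 y1 + t * k x2 y2.

(** The triangle is taken open because a convex function may jump at the edges; the edges do not
    contribute to the integrals. *)
Definition otri m : set (R * R) := [set p | [/\ 0 < p.1, 0 < p.2 & p.1 + p.2 < m]].

Lemma convex_otri m p q t : otri m p -> otri m q -> 0 <= t <= 1 ->
  otri m ((1 - t) * p.1 + t * q.1, (1 - t) * p.2 + t * q.2).
Proof.
move=> [p1 p2 pm] [q1 q2 qm] /andP[t0 t1].
have pos (a b : R) : 0 < a -> 0 < b -> 0 < (1 - t) * a + t * b.
  move=> a0 b0; have [->|tn0] := eqVneq t 0; first by lra.
  by rewrite ltr_wpDl ?mulr_ge0 ?mulr_gt0 ?subr_ge0// ?ltW// lt_neqAle eq_sym tn0.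
split => /=; [exact: pos|exact: pos|].
rewrite -subr_gt0; have := pos (m - (p.1 + p.2)) (m - (q.1 + q.2)).
by rewrite !subr_gt0 => /(_ pm qm); lra.
Qed.

Lemma otri_radially_open m p (d1 d2 : R) : otri m p ->
  exists2 r : R, 0 < r & otri m (p.1 + r * d1, p.2 + r * d2).
Proof.
move=> [p1 p2 pm].
(* With [e] the least of the three slacks, a step of length [e / D] changes each of the three
   defining quantities by less than [e]. *)
pose D := 1 + `|d1| + `|d2|.
pose e := Num.min (Num.min p.1 p.2) (m - p.1 - p.2).
have e0 : 0 < e by rewrite /e !lt_min p1 p2 /=; lra.
have [e1 e2 e3] : [/\ e <= p.1, e <= p.2 & e <= m - p.1 - p.2].
  by rewrite /e !ge_min !lexx !orbT.
have n1 := normr_ge0 d1; have n2 := normr_ge0 d2.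
have D0 : 0 < D by rewrite /D; lra.
exists (e / D); first by rewrite divr_gt0.
have r0 : 0 < e / D by rewrite divr_gt0.
have rD : e / D * D = e by rewrite divfK// gt_eqF.
move: r0 rD; set r := e / D => r0 rD.
have := ler_norm d1; have := ler_norm d2.
have := ler_norm (- d1); have := ler_norm (- d2); rewrite !normrN => f1 f2 f3 f4.
move: rD; rewrite /D => rD.
by split => /=; nra.
Qed.

(** A sublevel set in the open triangle is convex. It is also radially open: on a segment from [p]
    with [k p < a], the chord bound for [k] tends to its value at [p], hence stays below [a] near
    [p]. *)
Lemma convex2_measurable m k : convex2 m k ->
  measurable_fun (otri m) (fun p => k p.1 p.2).
Proof.
move=> ck; apply: measurable_fun_sublevel => a.
apply: convex_radially_open_measurable.
  move=> p q t [Tp kp] [Tq kq] t01; split; first exact: convex_otri.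
  move: Tp Tq => [p1 p2 pm] [q1 q2 qm] /=.
  apply: le_lt_trans (ck _ _ _ _ t _ _ _ _ _ _ t01) _; rewrite ?ltW//.
  move: kp kq t01 => /= kp kq /andP[t0 t1].
  have [->|tn0] := eqVneq t 0; first by lra.
  have t0' : 0 < t by rewrite lt_neqAle eq_sym tn0.
  have : t * k q.1 q.2 < t * a by rewrite ltr_pM2l.
  have : (1 - t) * k p.1 p.2 <= (1 - t) * a by rewrite ler_wpM2l ?subr_ge0// ltW.
  by lra.
move=> p d1 d2 [Tp kp].
have [r r0 Tr] := otri_radially_open d1 d2 Tp.
set kr := k (p.1 + r * d1) (p.2 + r * d2).
pose c := a - k p.1 p.2; have c0 : 0 < c by rewrite /c; move: kp => /=; lra.
(* For [s <= c / (2 * D)] the chord rises by at most [c / 2], half of the gap to [a]. The summand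
   [c] keeps [D] positive and this ratio below 1. *)
pose D := c + `|kr - k p.1 p.2|.
have D0 : 0 < D by rewrite /D ltr_pwDl.
have e0 : 0 < c / (2 * D) by rewrite divr_gt0// mulr_gt0.
have eD : c / (2 * D) * D = c / 2 by field; lra.
move: e0 eD; set e := c / (2 * D) => e0 eD.
have nk := normr_ge0 (kr - k p.1 p.2); have nk' := ler_norm (kr - k p.1 p.2).
have e1 : e < 1 by move: eD; rewrite /D => eD; nra.
exists (e * r); first by rewrite mulr_gt0.
move=> t /andP[t0 ter].
pose s := t / r.
have s0 : 0 <= s by rewrite divr_ge0// ltW.
have se : s <= e by rewrite /s ler_pdivrMr.
have tE : t = s * r by rewrite /s divfK// gt_eqF.
have s01 : 0 <= s <= 1 by rewrite s0; lra.
have E1 d z : z + t * d = (1 - s) * z + s * (z + r * d) by rewrite tE; ring.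
split; rewrite /= !E1; first exact: (convex_otri Tp Tr s01).
move: Tp Tr => [p1 p2 pm] [q1 q2 qm] /=.
apply: le_lt_trans (ck _ _ _ _ s _ _ _ _ _ _ s01) _; rewrite ?ltW//.
rewrite -/kr; move: eD; rewrite /D => eD.
have : s * (kr - k p.1 p.2) <= e * `|kr - k p.1 p.2|.
  by apply: (le_trans (ler_wpM2l s0 nk')); rewrite ler_wpM2r.
by rewrite /c in c0 eD *; nra.
Qed.

(** Above, the values at the three vertices bound [k]. Below, the centroid is one third of [(x, y)]
    plus two thirds of the point [(m / 2 - x / 2, m / 2 - y / 2)] of the triangle, where the upper
    bound applies. *)
Lemma convex2_bounded m k : convex2 m k ->
  exists M, forall x y, 0 <= x -> 0 <= y -> x + y <= m -> `|k x y| <= M.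
Proof.
move=> ck; pose A := `|k 0 0| + `|k m 0| + `|k 0 m|.
have n1 := normr_ge0 (k 0 0); have n2 := normr_ge0 (k m 0); have n3 := normr_ge0 (k 0 m).
have f1 := ler_norm (k 0 0); have f2 := ler_norm (k m 0); have f3 := ler_norm (k 0 m).
have upper (x y : R) : 0 <= x -> 0 <= y -> x + y <= m -> k x y <= A.
  move=> x0 y0 xym.
  have [xy0|xy0] := leP (x + y) 0.
    have -> : x = 0 by lra.
    have -> : y = 0 by lra.
    by rewrite /A; lra.
  have m0 : 0 < m by lra.
  have a0 (u v : R) : 0 <= u -> u <= v -> 0 < v -> 0 <= u / v <= 1.
    by move=> u0 uv v0; apply/andP; split; [rewrite divr_ge0// ltW | rewrite ler_pdivrMr// mul1r].
  have h1 : k (x + y) 0 <= A.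
    have t01 := a0 (x + y) m (ltW xy0) xym m0.
    have := ck 0 0 m 0 _ (lexx _) (lexx _) _ _ (lexx _) _ t01.
    rewrite !mulr0 !addr0 !add0r divfK ?gt_eqF// => /(_ (ltW m0) (ltW m0) (lexx _)).
    by move: t01; set t := _ / _ => /andP[t0 t1]; rewrite /A; nra.
  have h2 : k 0 (x + y) <= A.
    have t01 := a0 (x + y) m (ltW xy0) xym m0.
    have := ck 0 0 0 m _ (lexx _) (lexx _) _ (lexx _) _ _ t01.
    rewrite !mulr0 !addr0 !add0r divfK ?gt_eqF// => /(_ (ltW m0) (ltW m0) (lexx _)).
    by move: t01; set t := _ / _ => /andP[t0 t1]; rewrite /A; nra.
  (* The point lies on the segment from [(x + y, 0)] to [(0, x + y)], whose ends were bounded along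
     the two legs. *)
  have t01 : 0 <= y / (x + y) <= 1 by apply: a0 => //; lra.
  have := ck (x + y) 0 0 (x + y) _ (ltW xy0) (lexx _) _ (lexx _) (ltW xy0) _ t01.
  rewrite !mulr0 !addr0 !add0r => /(_ xym xym).
  have -> : (1 - y / (x + y)) * (x + y) = x by field; lra.
  rewrite divfK ?gt_eqF//.
  by move: t01; set t := _ / _ => /andP[t0 t1]; nra.
exists (2 * A + 3 * `|k (m / 3) (m / 3)|) => x y x0 y0 xym.
have nc := normr_ge0 (k (m / 3) (m / 3)).
have := ler_norm (- k (m / 3) (m / 3)); rewrite normrN => fc.
have u1 := upper x y x0 y0 xym.
have u2 : k (m / 2 - x / 2) (m / 2 - y / 2) <= A by apply: upper; lra.
have : k (m / 3) (m / 3) <= (1 - 2 / 3) * k x y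
    + 2 / 3 * k (m / 2 - x / 2) (m / 2 - y / 2).
  rewrite [X in k X _](_ : _ = (1 - 2 / 3) * x + 2 / 3 * (m / 2 - x / 2)); last by field.
  rewrite [X in k _ X](_ : _ = (1 - 2 / 3) * y + 2 / 3 * (m / 2 - y / 2)); last by field.
  by apply: ck; lra.
have A0 : 0 <= A by rewrite /A; lra.
by rewrite ler_norml => H; apply/andP; split; lra.
Qed.

Lemma convex2_bdd_mfun m k : convex2 m k -> bdd_mfun (otri m) (fun p => k p.1 p.2).
Proof.
move=> ck; split; first exact: convex2_measurable.
have [M kM] := convex2_bounded ck.
by exists M => -[x y] [/= x0 y0 xym]; apply: kM; exact: ltW.
Qed.

Lemma measurable_otri m : measurable (otri m).
Proof.
apply: convex_radially_open_measurable; first exact: convex_otri.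
move=> p d1 d2 Tp; have [r r0 Tr] := otri_radially_open d1 d2 Tp.
exists r => // t /andP[t0 tr].
have s01 : 0 <= t / r <= 1.
  by apply/andP; split; [rewrite divr_ge0// ltW | rewrite ler_pdivrMr// mul1r].
have := convex_otri Tp Tr s01.
by congr (otri m (_, _)) => /=; field; lra.
Qed.

End ConvexPlane.

(** * Iterated integrals over a triangle *)

Section TriangleIntegral.
Context {R : realType}.
Notation mu := (@lebesgue_measure R).
Implicit Types (m : R) (k h : R -> R -> R).

Definition tri_bdd_mfun m k := bdd_mfun (otri m) (fun p => k p.1 p.2).

Definition tri_int m k : R :=
  \int[mu]_(x in `[0, m]%classic) \int[mu]_(y in `[0, m - x]%classic) k x y.

Lemma mu_itvoo_lty (a b : R) : (mu `]a, b[%classic < +oo)%E.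
Proof. by rewrite lebesgue_measure_itv/=; case: ifP => // _; rewrite -EFinB ltry. Qed.

Lemma itvoo_integrable (a b : R) (g : R -> R) : bdd_mfun `]a, b[%classic g ->
  mu.-integrable `]a, b[%classic (EFin \o g).
Proof.
by move=> bg; apply: bdd_mfun_integrable => //; exact: mu_itvoo_lty.
Qed.

Lemma tri_bdd_mfun_swap m k : tri_bdd_mfun m k -> tri_bdd_mfun m (fun x y => k y x).
Proof.
have sw p : otri m p -> otri m (p.2, p.1).
  by move=> [p1 p2 pm]; split => //=; rewrite addrC.
move=> [mk [M kM]]; split; last by exists M => p /sw /kM.
apply: (@measurable_comp _ _ _ _ _ _ (otri m) (fun p => k p.1 p.2) _ (fun p => (p.2, p.1))) => //.
- exact: measurable_otri.
- by move=> _ [p /sw Tp <-].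
- by apply: measurable_funTS; exact: measurable_fun_pair.
Qed.

Lemma tri_bdd_mfunD m k h : tri_bdd_mfun m k -> tri_bdd_mfun m h ->
  tri_bdd_mfun m (fun x y => k x y + h x y).
Proof. exact: bdd_mfunD. Qed.

Lemma tri_bdd_mfunM m k h : tri_bdd_mfun m k -> tri_bdd_mfun m h ->
  tri_bdd_mfun m (fun x y => k x y * h x y).
Proof. exact: bdd_mfunM. Qed.

Lemma tri_bdd_mfun_section m k x : 0 < x -> tri_bdd_mfun m k ->
  bdd_mfun `]0, m - x[%classic (k x).
Proof.
move=> x0 [mk [M kM]].
have sec y : `]0, m - x[%classic y -> otri m (x, y).
  by rewrite /= in_itv/= => /andP[y0 yx]; split => //=; lra.
split; last by exists M => y /sec /kM.
apply: (@measurable_comp _ _ _ _ _ _ (otri m) (fun p => k p.1 p.2) _ (pair x)) => //.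
- exact: measurable_otri.
- by move=> _ [y /sec Tp <-].
- exact/measurable_funTS/pair1_measurable.
Qed.

(** Extension by zero to the whole plane, where Fubini's theorem for the product measure applies. *)
Let ext m k : R * R -> \bar R :=
  EFin \o ((fun p => k p.1 p.2) \_ (otri m)).

Lemma mu_otri_lty m : ((mu \x mu)%E (otri m) < +oo)%E.
Proof.
apply: (@le_lt_trans _ _ ((mu \x mu)%E (`[0, m]%classic `*` `[0, m]%classic))).
  apply: le_measure; rewrite ?inE; [exact: measurable_otri|exact: measurableX|].
  by move=> [x y] [/= x0 y0 xym]; split; rewrite /= in_itv/=; lra.
rewrite product_measure1E//; apply: lte_mul_pinfty => //; last exact: mu_itvcc_lty.
by rewrite ge0_fin_numE// mu_itvcc_lty.
Qed.

Lemma integrable_ext m k : tri_bdd_mfun m k ->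
  (mu \x mu)%E.-integrable setT (ext m k).
Proof.
move=> bk; rewrite /ext -restrict_EFin.
apply: (iffLR (@integrable_mkcond _ _ R (mu \x mu)%E (otri m) (EFin \o (fun p => k p.1 p.2)) _)); first exact: measurable_otri.
apply: bdd_mfun_integrable => //; [exact: measurable_otri|exact: mu_otri_lty].
Qed.

Lemma section_ext m k x : tri_bdd_mfun m k ->
  (\int[mu]_y ext m k (x, y) =
   (((fun x => \int[mu]_(y in `[0, m - x]%classic) k x y) \_ `]0, m[%classic) x)%:E)%E.
Proof.
move=> bk; rewrite /patch; case: ifPn => [|xm]; last first.
  under eq_integral => y _.
    rewrite /ext/= patchE ifF; last first.
      apply/negbTE; apply: contra xm; rewrite !inE => -[/= x0 y0 xym].
      by rewrite in_itv/=; lra.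
    over.
  by rewrite integral0.
rewrite inE/= in_itv/= => /andP[x0 xm].
have bs := tri_bdd_mfun_section x0 bk.
rewrite /Rintegral fineK; last first.
  apply: integrable_fin_num => //.
  by apply: itv_integrable; exact: bdd_mfun_itvoo_cc.
rewrite integral_itv_bndoo; last by apply/measurable_EFinP; case: bs.
rewrite [RHS]integral_mkcond; apply: eq_integral => y _.
rewrite /ext/= !patchE.
have -> : ((x, y) \in otri m) = (y \in `]0, m - x[%classic).
  apply/idP/idP; rewrite !inE/= in_itv/=; first by move=> [/= _ y0 xym]; rewrite y0/=; lra.
  by move=> /andP[y0 yx]; split => //=; lra.
by case: ifP.
Qed.

(** For [0 < x < m] the inner integral is a marginal of [ext m k], hence measurable, and is at most
    [|M| * m] in absolute value; the ends [x = 0] and [x = m] are then added. *)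
Lemma tri_bdd_mfun_inner m k : tri_bdd_mfun m k ->
  bdd_mfun `[0, m]%classic (fun x => \int[mu]_(y in `[0, m - x]%classic) k x y).
Proof.
move=> bk; apply: bdd_mfun_itvoo_cc; split.
  apply/measurable_restrictT => //; apply/measurable_EFinP.
  apply: eq_measurable_fun (measurable_fubini_F (integrable_ext bk)) => x _.
  exact: section_ext.
have [mk [M kM]] := bk.
exists (`|M| * m) => x /=; rewrite in_itv/= => /andP[x0 xm].
have bs := bdd_mfun_itvoo_cc (tri_bdd_mfun_section x0 bk).
have bs' := tri_bdd_mfun_section x0 bk.
rewrite itv_int_oo//.
have ik := itvoo_integrable bs'.
apply: (le_trans (le_normr_Rintegral _ ik)) => //.
apply: (@le_trans _ _ (\int[mu]_(y in `]0, m - x[%classic) `|M|)).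
  apply: le_Rintegral => //.
  - exact: integrable_norm.
  - exact/itvoo_integrable/bdd_mfun_cst.
  - move=> y /=; rewrite in_itv/= => /andP[y0 yx].
    apply: (le_trans (kM (x, y) _)) (ler_norm _).
    by split => //=; lra.
rewrite Rintegral_cst// ler_wpM2l//= lebesgue_measure_itv/= lte_fin.
by case: ifPn => _; rewrite -?EFinB/=; lra.
Qed.

Lemma tri_int_ext m k : tri_bdd_mfun m k ->
  tri_int m k = fine (\int[mu]_x \int[mu]_y ext m k (x, y))%E.
Proof.
move=> bk; rewrite /tri_int.
have bi := tri_bdd_mfun_inner bk.
rewrite itv_int_oo; last first.
  by apply: bdd_mfunS bi => // x /=; rewrite !in_itv/= => /andP[/ltW -> /ltW ->].
rewrite Rintegral_mkcond /Rintegral; congr fine.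
by apply: eq_integral => x _; rewrite section_ext.
Qed.

Lemma tri_int_swap m k : tri_bdd_mfun m k ->
  tri_int m k = tri_int m (fun x y => k y x).
Proof.
move=> bk; rewrite (tri_int_ext bk) (tri_int_ext (tri_bdd_mfun_swap bk)).
rewrite (Fubini (integrable_ext bk)); congr fine.
apply: eq_integral => y _; apply: eq_integral => x _.
rewrite /ext/= !patchE; congr (if _ then _ else _)%:E.
by apply/idP/idP; rewrite !inE => -[/= h1 h2 h3]; split => //=; rewrite addrC.
Qed.

Lemma tri_intD m k h : tri_bdd_mfun m k -> tri_bdd_mfun m h ->
  tri_int m (fun x y => k x y + h x y) = tri_int m k + tri_int m h.
Proof.
move=> bk bh; have ik := tri_bdd_mfun_inner bk; have ih := tri_bdd_mfun_inner bh.
have ikh := tri_bdd_mfun_inner (tri_bdd_mfunD bk bh).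
have sub (g : R -> R) : bdd_mfun `[0, m]%classic g -> bdd_mfun `]0, m[%classic g.
  by apply: bdd_mfunS => // x /=; rewrite !in_itv/= => /andP[/ltW -> /ltW ->].
(* At [x = 0] the section is an edge outside the open triangle, where nothing is known of [k] and
   [h]; the outer integral is therefore taken over the open interval. *)
rewrite /tri_int -itv_intD// [LHS]itv_int_oo; last exact: sub.
rewrite [RHS]itv_int_oo; last by apply: sub; exact: bdd_mfunD.
apply: eq_Rintegral => x; rewrite inE/= in_itv/= => /andP[x0 xm].
by rewrite itv_intD//; exact/bdd_mfun_itvoo_cc/tri_bdd_mfun_section.
Qed.

Lemma tri_intZ m c k : tri_bdd_mfun m k ->
  tri_int m (fun x y => c * k x y) = c * tri_int m k.
Proof.
move=> bk; have ik := tri_bdd_mfun_inner bk.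
have sub (g : R -> R) : bdd_mfun `[0, m]%classic g -> bdd_mfun `]0, m[%classic g.
  by apply: bdd_mfunS => // x /=; rewrite !in_itv/= => /andP[/ltW -> /ltW ->].
have bck : tri_bdd_mfun m (fun x y => c * k x y).
  by apply: bdd_mfunM => //; exact: bdd_mfun_cst.
have ick := tri_bdd_mfun_inner bck.
rewrite /tri_int -itv_intZ// [LHS]itv_int_oo; last exact: sub.
rewrite [RHS]itv_int_oo; last by apply: sub; apply: bdd_mfunM => //; exact: bdd_mfun_cst.
apply: eq_Rintegral => x; rewrite inE/= in_itv/= => /andP[x0 xm].
by rewrite itv_intZ//; exact/bdd_mfun_itvoo_cc/tri_bdd_mfun_section.
Qed.

Lemma eq_tri_int m k h :
  (forall x y, 0 <= x -> 0 <= y -> x + y <= m -> k x y = h x y) ->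
  tri_int m k = tri_int m h.
Proof.
move=> kh; apply: eq_itv_int => x /andP[x0 xm]; apply: eq_itv_int => y /andP[y0 yx].
by apply: kh => //; lra.
Qed.

End TriangleIntegral.

(** * Iterated integrals over the standard simplex *)

Section TetrahedronIntegral.
Context {R : realType}.
Notation mu := (@lebesgue_measure R).
Implicit Types (m c : R) (g : R -> R) (k : R -> R -> R) (F : R -> R -> R -> R).

(** Every chord slope to the left of [c] is at most every chord slope to its right, so the supremum
    of the left slopes is the slope of a supporting line. *)
Lemma convex1_support m g c : convex1 m g -> 0 < c < m ->
  exists a, forall x, 0 <= x <= m -> g c + a * (x - c) <= g x.
Proof.
move=> cg /andP[c0 cm].
have slopes (x y : R) : 0 <= x -> x < c -> c < y -> y <= m ->
    (g c - g x) / (c - x) <= (g y - g c) / (y - c).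
  move=> x0 xc cy ym.
  have [xc0 cy0 xy0] : [/\ 0 < c - x, 0 < y - c & 0 < y - x] by split; lra.
  have := cg x y ((c - x) / (y - x)).
  have -> : (1 - (c - x) / (y - x)) * x + (c - x) / (y - x) * y = c by field; lra.
  have h1 : 0 <= x <= m by apply/andP; split; lra.
  have h2 : 0 <= y <= m by apply/andP; split; lra.
  have h3 : 0 <= (c - x) / (y - x) <= 1.
    by apply/andP; split; [rewrite divr_ge0//; lra | rewrite ler_pdivrMr//; lra].
  move=> /(_ h1 h2 h3).
  rewrite -(ler_pM2r xy0).
  have -> : ((1 - (c - x) / (y - x)) * g x + (c - x) / (y - x) * g y) * (y - x) =
    (y - c) * g x + (c - x) * g y by field; lra.
  by move=> H; rewrite ler_pdivrMr// mulrAC ler_pdivlMr//; lra.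
pose S := [set (g c - g x) / (c - x) | x in [set x | 0 <= x /\ x < c]].
have supS : has_sup S.
  split; first by exists ((g c - g 0) / (c - 0)); exists 0.
  by exists ((g m - g c) / (m - c)) => _ [x [x0 xc] <-]; exact: slopes.
exists (sup S) => x /andP[x0 xm].
have [xc|cx|->] := ltgtP x c; last by rewrite subrr mulr0 addr0.
- have : (g c - g x) / (c - x) <= sup S by apply: ub_le_sup; [case: supS|exists x].
  by rewrite ler_pdivrMr; [lra|lra].
- have : sup S <= (g x - g c) / (x - c).
    by apply: ge_sup; [case: supS|move=> _ [y [y0 yc] <-]; exact: slopes].
  by rewrite ler_pdivlMr; [lra|lra].
Qed.

Lemma itv_int_scale_itv m c g : 0 <= m -> 0 <= c -> bdd_mfun `[0, m * c]%classic g ->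
  \int[mu]_(x in `[0, m * c]%classic) g x =
  m * \int[mu]_(x in `[0, c]%classic) g (m * x).
Proof.
move=> m0 c0 bg; rewrite (@itv_int_scale _ (m * c)) ?mulr_ge0//.
rewrite [in RHS](@itv_int_scale _ c)//.
  by rewrite mulrA; congr (_ * _); apply: eq_itv_int => x _; rewrite mulrA.
have := @bdd_mfun_affine _ m 0 0 c 0 (m * c) g.
under [X in _ -> _ -> bdd_mfun _ X]eq_fun do rewrite addr0.
by apply=> // x /andP[x0 xc]; rewrite addr0 mulr_ge0//= ler_wpM2l.
Qed.

Lemma convex2_section m k x : convex2 m k -> 0 <= x -> convex1 (m - x) (k x).
Proof.
move=> ck x0 y1 y2 t /andP[y10 y1m] /andP[y20 y2m] t01.
rewrite [X in k X _](_ : x = (1 - t) * x + t * x); last by ring.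
by apply: ck => //; lra.
Qed.

Lemma convex2_scale m k : 0 <= m -> convex2 m k ->
  convex2 1 (fun x y => k (m * x) (m * y)).
Proof.
move=> m0 ck x1 y1 x2 y2 t x10 y10 xy1 x20 y20 xy2 t01.
rewrite (_ : m * _ = (1 - t) * (m * x1) + t * (m * x2)); last by ring.
rewrite (_ : m * (_ + t * y2) = (1 - t) * (m * y1) + t * (m * y2)); last by ring.
by apply: ck; rewrite ?mulr_ge0// -mulrDr -[leRHS]mulr1 ler_wpM2l.
Qed.

Lemma tri_int_scale m k : 0 <= m -> convex2 m k ->
  tri_int m k = m ^+ 2 * tri_int 1 (fun x y => k (m * x) (m * y)).
Proof.
move=> m0 ck; rewrite /tri_int itv_int_scale//; last first.
  exact/tri_bdd_mfun_inner/convex2_bdd_mfun.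
rewrite expr2 -mulrA; congr (_ * _).
rewrite -itv_intZ; last first.
  exact/tri_bdd_mfun_inner/convex2_bdd_mfun/convex2_scale.
apply: eq_itv_int => x /andP[x0 x1].
have -> : m - m * x = m * (1 - x) by ring.
rewrite itv_int_scale_itv ?subr_ge0//.
apply/convex1_bdd_mfun.
have -> : m * (1 - x) = m - m * x by ring.
by apply: convex2_section => //; rewrite mulr_ge0.
Qed.

Lemma le_tri_int m k h : tri_bdd_mfun m k -> tri_bdd_mfun m h ->
  (forall x y, 0 <= x -> 0 <= y -> x + y <= m -> k x y <= h x y) ->
  tri_int m k <= tri_int m h.
Proof.
move=> bk bh kh; have ik := tri_bdd_mfun_inner bk; have ih := tri_bdd_mfun_inner bh.
have sub (g : R -> R) : bdd_mfun `[0, m]%classic g -> bdd_mfun `]0, m[%classic g.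
  by apply: bdd_mfunS => // x /=; rewrite !in_itv/= => /andP[/ltW -> /ltW ->].
rewrite /tri_int (itv_int_oo (sub _ ik)) (itv_int_oo (sub _ ih)).
apply: le_Rintegral => //; [exact/itvoo_integrable/sub|exact/itvoo_integrable/sub|].
move=> x /=; rewrite in_itv/= => /andP[x0 xm].
apply: le_itv_int; [exact/bdd_mfun_itvoo_cc/tri_bdd_mfun_section..|].
by move=> y /andP[y0 yx]; apply: kh => //; lra.
Qed.

Definition simplex3 (x y z : R) := [/\ 0 <= x, 0 <= y, 0 <= z & x + y + z <= 1].

Definition convex3 F := forall x1 y1 z1 x2 y2 z2 t,
  simplex3 x1 y1 z1 -> simplex3 x2 y2 z2 -> 0 <= t <= 1 ->
  F ((1 - t) * x1 + t * x2) ((1 - t) * y1 + t * y2) ((1 - t) * z1 + t * z2)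
    <= (1 - t) * F x1 y1 z1 + t * F x2 y2 z2.

Definition tet_int F : R :=
  tri_int 1 (fun x y => \int[mu]_(z in `[0, 1 - x - y]%classic) F x y z).

Lemma convex3_section12 F x y : convex3 F -> 0 <= x -> 0 <= y -> x + y <= 1 ->
  convex1 (1 - x - y) (F x y).
Proof.
move=> cF x0 y0 xy z1 z2 t /andP[z10 z1m] /andP[z20 z2m] t01.
have := cF x y z1 x y z2 t; rewrite -!mulrDl subrK !mul1r; apply => //.
  by split=> //; lra.
by split=> //; lra.
Qed.

Lemma convex3_section1 F x : convex3 F -> 0 <= x <= 1 -> convex2 (1 - x) (F x).
Proof.
move=> cF /andP[x0 x1] y1 z1 y2 z2 t y10 z10 yz1 y20 z20 yz2 t01.
have := cF x y1 z1 x y2 z2 t; rewrite -!mulrDl subrK !mul1r; apply => //.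
  by split=> //; lra.
by split=> //; lra.
Qed.

Lemma convex3_rot F : convex3 F -> convex3 (fun x y z => F z x y).
Proof.
move=> cF x1 y1 z1 x2 y2 z2 t [? ? ? ?] [? ? ? ?] t01.
by apply: cF => //; split=> //; lra.
Qed.

(** The inner integral need not be convex, since the length of its interval varies. Rescaled to
    [[0, 1]] it is the product of the affine length [1 - x - y] and the convex function [kF], both
    bounded and measurable. *)
Lemma tri_bdd_mfun_tet_inner F : convex3 F ->
  tri_bdd_mfun 1 (fun x y => \int[mu]_(z in `[0, 1 - x - y]%classic) F x y z).
Proof.
move=> cF.
pose kF x y := \int[mu]_(z in `[0, 1]%classic) F x y ((1 - x - y) * z).
have simp (x y z : R) : 0 <= x -> 0 <= y -> x + y <= 1 -> 0 <= z <= 1 ->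
    simplex3 x y ((1 - x - y) * z).
  move=> x0 y0 xy /andP[z0 z1]; have w0 : 0 <= 1 - x - y by lra.
  by split=> //; nra.
have bF (x y : R) : 0 <= x -> 0 <= y -> x + y <= 1 ->
    bdd_mfun `[0, (1 : R)]%classic (fun z => F x y ((1 - x - y) * z)).
  move=> x0 y0 xy; apply: convex1_bdd_mfun => z1 z2 t z101 z201 t01.
  have := cF x y ((1 - x - y) * z1) x y ((1 - x - y) * z2) t.
  rewrite -!mulrDl subrK !mul1r => H.
  rewrite (_ : (1 - x - y) * _ =
    (1 - t) * ((1 - x - y) * z1) + t * ((1 - x - y) * z2)); last by ring.
  by apply: H => //; exact: simp.
have ckF : convex2 1 kF.
  move=> x1 y1 x2 y2 t x10 y10 xy1 x20 y20 xy2 t01.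
  have [t0 t1] := andP t01.
  have b1 := bF _ _ x10 y10 xy1; have b2 := bF _ _ x20 y20 xy2.
  rewrite /kF -!itv_intZ// -itv_intD; try by apply: bdd_mfunM => //; exact: bdd_mfun_cst.
  apply: le_itv_int.
  - by apply: bF; nra.
  - by apply: bdd_mfunD; apply: bdd_mfunM => //; exact: bdd_mfun_cst.
  move=> z z01.
  rewrite (_ : (1 - (_ + _) - (_ + _)) * z =
    (1 - t) * ((1 - x1 - y1) * z) + t * ((1 - x2 - y2) * z)); last by ring.
  by apply: cF => //; exact: simp.
have cw : convex2 1 (fun x y : R => 1 - x - y).
  by move=> *; lra.
have := tri_bdd_mfunM (convex2_bdd_mfun cw) (convex2_bdd_mfun ckF).
apply: eq_bdd_mfun => -[x y] [/= x0 y0 xy].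
have w0 : 0 <= 1 - x - y by lra.
rewrite [RHS]itv_int_scale//.
by apply/convex1_bdd_mfun/convex3_section12 => //; lra.
Qed.

(** The cyclic rotation is a product of two transpositions: swap [x] and [y] outside, then [x] and
    [z] in the slice at fixed [y]. *)
Lemma tet_int_rot F : convex3 F -> tet_int F = tet_int (fun x y z => F z x y).
Proof.
move=> cF; rewrite /tet_int tri_int_swap; last exact: tri_bdd_mfun_tet_inner.
apply: eq_itv_int => y y01.
transitivity (tri_int (1 - y) (fun x z => F x y z)).
  by apply: eq_itv_int => x _; rewrite addrAC.
rewrite tri_int_swap//; apply: convex2_bdd_mfun.
move=> x1 z1 x2 z2 t x10 z10 xz1 x20 z20 xz2 t01.
have /andP[y0 y1] := y01.
have := cF x1 y z1 x2 y z2 t; rewrite -(mulrDl _ _ y) subrK mul1r; apply => //.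
  by split=> //; lra.
by split=> //; lra.
Qed.

(* Rotating the coordinates puts the first variable innermost, so that the cut is
   made on each segment parallel to it. *)
Lemma tet_int_split F s : convex3 F -> 0 <= s <= 1 ->
  tet_int F = s * tet_int (fun x y z => F (s * x) y z) +
              (1 - s) * tet_int (fun x y z => F (1 - y - z - (1 - s) * x) y z).
Proof.
move=> cF /andP[s0 s1].
have c0 : convex3 (fun x y z => F (s * x) y z).
  move=> x1 y1 z1 x2 y2 z2 t [? ? ? ?] [? ? ? ?] t01.
  rewrite (_ : s * _ = (1 - t) * (s * x1) + t * (s * x2)); last by ring.
  by apply: cF => //; split=> //; nra.
have c1 : convex3 (fun x y z => F (1 - y - z - (1 - s) * x) y z).
  move=> x1 y1 z1 x2 y2 z2 t [? ? ? ?] [? ? ? ?] t01.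
  rewrite (_ : 1 - (_ + _) - _ - _ =
    (1 - t) * (1 - y1 - z1 - (1 - s) * x1) + t * (1 - y2 - z2 - (1 - s) * x2)); last by ring.
  by apply: cF => //; split=> //; nra.
rewrite (tet_int_rot cF) (tet_int_rot c0) (tet_int_rot c1).
rewrite /tet_int -!tri_intZ; try exact: (tri_bdd_mfun_tet_inner (convex3_rot _)).
have cst (a : R) : tri_bdd_mfun 1 (fun _ _ => a) by exact: bdd_mfun_cst.
rewrite -tri_intD; try by apply: tri_bdd_mfunM => //;
  exact: (tri_bdd_mfun_tet_inner (convex3_rot _)).
apply: eq_tri_int => y z y0 z0 yz.
have L0 : 0 <= 1 - y - z by lra.
have bF : bdd_mfun `[0, 1 - y - z]%classic (fun x => F x y z).
  exact/convex1_bdd_mfun/(convex3_section12 (convex3_rot cF)).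
set L := 1 - y - z in L0 bF *.
(* Rescaling the pieces of lengths [s * L] and [(1 - s) * L] back to length [L] produces the weights
   [s] and [1 - s]. *)
rewrite (@itv_int_split _ L (s * L))//; last by apply/andP; split; nra.
have -> : L - s * L = (1 - s) * L by ring.
rewrite !itv_int_scale_itv//; last 2 first.
- have := @bdd_mfun_affine _ (-1) L 0 ((1 - s) * L) 0 L (fun x => F x y z).
  move=> /(_ _ bF) H; apply: eq_bdd_mfun (H _).
    by move=> x _; congr (F _ y z); ring.
  by move=> x /andP[x0 x1]; apply/andP; split; nra.
- by apply: bdd_mfunS bF => // x /=; rewrite !in_itv/= => /andP[x0 xs]; apply/andP; split; nra.
by rewrite subr_ge0.
Qed.

Lemma itv_int_onemXn n : \int[mu]_(x in `[0, 1]%classic) (1 - x) ^+ n = n.+1%:R^-1 :> R.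
Proof. exact: Rintegral_onemXn. Qed.

Lemma bdd_mfun_onemXn n : bdd_mfun `[0, (1 : R)]%classic (fun x : R => (1 - x) ^+ n).
Proof.
elim: n => [|n IH].
  by apply: eq_bdd_mfun (bdd_mfun_cst _ 1) => x _; rewrite expr0.
apply: eq_bdd_mfun (bdd_mfunM (bdd_mfunD (bdd_mfun_cst _ 1)
  (bdd_mfunM (bdd_mfun_cst _ (-1)) (bdd_mfun_id 0 1))) IH) => x _.
by rewrite exprS mulN1r.
Qed.

(** * Slices of the simplex and the two bounds for its integral *)

Section Slices.
Variable F : R -> R -> R -> R.
Hypothesis cF : convex3 F.

(* Up to the factor (1 - u) ^+ 2, the integral over the slice at height u. *)
Definition slice_int u := tri_int 1 (fun v w => F u ((1 - u) * v) ((1 - u) * w)).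

Lemma convex2_slice u : 0 <= u <= 1 ->
  convex2 1 (fun v w => F u ((1 - u) * v) ((1 - u) * w)).
Proof.
move=> u01; apply: convex2_scale; first by case/andP: u01; lra.
exact: convex3_section1.
Qed.

(** For fixed [v] and [w] the point [(u, (1 - u) * v, (1 - u) * w)] is affine in [u], so the
    integrand is already convex in [u]. *)
Lemma convex1_slice_int : convex1 1 slice_int.
Proof.
move=> u1 u2 t u101 u201 t01.
have bcst (a : R) : tri_bdd_mfun 1 (fun _ _ => a) by exact: bdd_mfun_cst.
have b1 := convex2_bdd_mfun (convex2_slice u101).
have b2 := convex2_bdd_mfun (convex2_slice u201).
have u01 : 0 <= (1 - t) * u1 + t * u2 <= 1.
  by case/andP: u101; case/andP: u201; case/andP: t01 => *; apply/andP; split; nra.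
rewrite /slice_int -!tri_intZ// -tri_intD; try exact: tri_bdd_mfunM.
apply: le_tri_int.
- exact/convex2_bdd_mfun/convex2_slice.
- by apply: tri_bdd_mfunD; exact: tri_bdd_mfunM.
move=> v w v0 w0 vw.
rewrite (_ : (1 - _) * v = (1 - t) * ((1 - u1) * v) + t * ((1 - u2) * v)); last by ring.
rewrite (_ : (1 - _) * w = (1 - t) * ((1 - u1) * w) + t * ((1 - u2) * w)); last by ring.
by apply: cF => //; [case/andP: u101|case/andP: u201] => *; split=> //; nra.
Qed.

Lemma tet_int_slice :
  tet_int F = \int[mu]_(u in `[0, 1]%classic) ((1 - u) ^+ 2 * slice_int u).
Proof.
apply: eq_itv_int => u /andP[u0 u1].
rewrite -[LHS]/(tri_int (1 - u) (F u)) tri_int_scale ?subr_ge0//.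
by apply: convex3_section1 => //; rewrite u0.
Qed.

Lemma tri_int_cst (a : R) : tri_int 1 (fun _ _ => a) = a / 2.
Proof.
have bcst (b : R) : tri_bdd_mfun 1 (fun _ _ => b) by exact: bdd_mfun_cst.
have := tri_intZ a (bcst 1); under eq_tri_int do rewrite mulr1.
move=> ->; congr (_ * _); rewrite -(itv_int_onemXn 1).
apply: eq_itv_int => x /andP[x0 x1]; rewrite expr1 Rintegral_cst// mul1r.
by rewrite /= lebesgue_measure_itv/= lte_fin; case: ltP => h; rewrite -?EFinB/=; lra.
Qed.

Lemma tet_int_le : tet_int F <= slice_int 0 / 4 + F 1 0 0 / 24.
Proof.
have S1 : slice_int 1 = F 1 0 0 / 2.
  by rewrite -tri_int_cst; apply: eq_tri_int => v w *; rewrite subrr !mul0r.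
have b2 := bdd_mfun_onemXn 2; have b3 := bdd_mfun_onemXn 3.
have bc (a : R) : bdd_mfun `[0, (1 : R)]%classic (fun=> a) by exact: bdd_mfun_cst.
rewrite tet_int_slice.
(* The chord [(1 - u) * g0 + u * g1] times [(1 - u) ^+ 2], in powers of [1 - u]. The moments 1/4 and
   1/3 give [g0 / 4 + g1 / 12], and [g1] is half the value at the apex. *)
apply: (@le_trans _ _ (\int[mu]_(u in `[0, 1]%classic)
   ((slice_int 0 - slice_int 1) * (1 - u) ^+ 3 + slice_int 1 * (1 - u) ^+ 2))).
  apply: le_itv_int.
  - by apply: bdd_mfunM => //; exact/convex1_bdd_mfun/convex1_slice_int.
  - by apply: bdd_mfunD; exact: bdd_mfunM.
  move=> u u01; have := convex1_slice_int (x := 0) (y := 1) (t := u).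
  rewrite mulr0 add0r mulr1 !lexx ler01 => /(_ isT isT u01) H.
  have q0 : 0 <= (1 - u) ^+ 2 by exact: sqr_ge0.
  move: (slice_int 0) (slice_int 1) (slice_int u) H => a b c H.
  by have := ler_wpM2l q0 H; rewrite exprS; lra.
move: S1; move: (slice_int 0) (slice_int 1) => a b ->.
by rewrite itv_intD ?itv_intZ ?itv_int_onemXn//; [lra|exact: bdd_mfunM..].
Qed.

(* The weight (1 - u) ^+ 2 has its barycentre at u = 1/4, so a supporting line there
   integrates to its value at 1/4. *)
Lemma tet_int_ge : slice_int 4^-1 / 3 <= tet_int F.
Proof.
have c14 : 0 < (4^-1 : R) < 1 by apply/andP; split; lra.
have [a Ha] := convex1_support convex1_slice_int c14.
have b2 := bdd_mfun_onemXn 2; have b3 := bdd_mfun_onemXn 3.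
have bc (b : R) : bdd_mfun `[0, (1 : R)]%classic (fun=> b) by exact: bdd_mfun_cst.
rewrite tet_int_slice.
(* The supporting line in powers of [1 - u], from [u - 1/4 = 3/4 - (1 - u)]; the terms in [a]
   integrate to [- a / 4 + a / 4 = 0]. *)
apply: (@le_trans _ _ (\int[mu]_(u in `[0, 1]%classic)
   (- a * (1 - u) ^+ 3 + (slice_int 4^-1 + a * (3 / 4)) * (1 - u) ^+ 2))).
  by rewrite itv_intD ?itv_intZ ?itv_int_onemXn//; [lra|exact: bdd_mfunM..].
apply: le_itv_int.
- by apply: bdd_mfunD; exact: bdd_mfunM.
- by apply: bdd_mfunM => //; exact/convex1_bdd_mfun/convex1_slice_int.
move=> u u01; have q0 : 0 <= (1 - u) ^+ 2 by exact: sqr_ge0.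
have := Ha u u01; move: (slice_int 4^-1) (slice_int u) => b c H.
by have := ler_wpM2l q0 H; rewrite exprS; lra.
Qed.

End Slices.
End TetrahedronIntegral.

(** * Averages over a tetrahedron *)

Section TetrahedronAverage.
Context {R : realType}.
Notation vec := 'rV[R]_3.
Implicit Types (f : vec -> R) (o p q r t x : vec).

Definition barycentric f p q r t (u v w : R) :=
  f (p + u *: (q - p) + v *: (r - p) + w *: (t - p)).

Lemma tet_avgE f p q r t : tet_avg f p q r t = 6 * tet_int (barycentric f p q r t).
Proof. by []. Qed.

Lemma tri_avgE f p q r :
  tri_avg f p q r = 2 * tri_int 1 (fun u v => f (p + u *: (q - p) + v *: (r - p))).
Proof. by []. Qed.

Lemma in_tet_barycentric p q r t u v w : simplex3 u v w ->
  in_tet p q r t (p + u *: (q - p) + v *: (r - p) + w *: (t - p)).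
Proof.
move=> [u0 v0 w0 uvw]; exists (1 - u - v - w), u, v, w.
split; first by split => //; lra.
split; first by ring.
by apply/rowP => i; rewrite !mxE; ring.
Qed.

Lemma convex3_barycentric f p q r t :
  convex_on_tet f p q r t -> convex3 (barycentric f p q r t).
Proof.
move=> cf u1 v1 w1 u2 v2 w2 c s1 s2 c01; rewrite /barycentric.
have := cf _ _ c (in_tet_barycentric p q r t s1) (in_tet_barycentric p q r t s2) c01.
by congr (f _ <= _); apply/rowP => i; rewrite !mxE; ring.
Qed.

Lemma tet_avg_le f p q r t : convex_on_tet f p q r t ->
  tet_avg f p q r t <= 1 / 4 * f q + 3 / 4 * tri_avg f p r t.
Proof.
move=> /convex3_barycentric cF; have := tet_int_le cF.
rewrite tet_avgE tri_avgE.
have -> : barycentric f p q r t 1 0 0 = f q.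
  by congr f; apply/rowP => i; rewrite !mxE; ring.
have -> : slice_int (barycentric f p q r t) 0 =
    tri_int 1 (fun u v => f (p + u *: (r - p) + v *: (t - p))).
  by apply: eq_tri_int => v w *; congr f; apply/rowP => i; rewrite !mxE; ring.
by lra.
Qed.

Lemma tet_avg_ge f p q r t : convex_on_tet f p q r t ->
  tri_avg f (homothety q (3 / 4) p) (homothety q (3 / 4) r) (homothety q (3 / 4) t)
    <= tet_avg f p q r t.
Proof.
move=> /convex3_barycentric cF; have := tet_int_ge cF.
rewrite tet_avgE tri_avgE.
have -> : slice_int (barycentric f p q r t) 4^-1 =
    tri_int 1 (fun u v => f (homothety q (3 / 4) p
      + u *: (homothety q (3 / 4) r - homothety q (3 / 4) p)
      + v *: (homothety q (3 / 4) t - homothety q (3 / 4) p))).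
  by apply: eq_tri_int => v w *; congr f; apply/rowP => i; rewrite !mxE; field.
by lra.
Qed.

(** The first coordinate runs from [p] towards [q]. In the half at [q] it is measured backwards, [p]
    receiving weight [(1 - s) * u] and [q] the rest. *)
Lemma tet_avg_split f p q r t s : convex_on_tet f p q r t -> 0 <= s <= 1 ->
  tet_avg f p q r t = s * tet_avg f p ((1 - s) *: p + s *: q) r t
                      + (1 - s) * tet_avg f q ((1 - s) *: p + s *: q) r t.
Proof.
move=> /convex3_barycentric cF s01; rewrite !tet_avgE (tet_int_split cF s01).
have -> : tet_int (fun u v w => barycentric f p q r t (s * u) v w) =
    tet_int (barycentric f p ((1 - s) *: p + s *: q) r t).
  apply: eq_tri_int => u v *; apply: eq_itv_int => w _; congr f.
  by apply/rowP => i; rewrite !mxE; ring.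
have -> : tet_int (fun u v w => barycentric f p q r t (1 - v - w - (1 - s) * u) v w) =
    tet_int (barycentric f q ((1 - s) *: p + s *: q) r t).
  apply: eq_tri_int => u v *; apply: eq_itv_int => w _; congr f.
  by apply/rowP => i; rewrite !mxE; ring.
move: (tet_int _) (tet_int _) => a b.
by ring.
Qed.

Lemma convex_on_tet_sub f p q r t p' q' r' t' :
  (forall x, in_tet p' q' r' t' x -> in_tet p q r t x) ->
  convex_on_tet f p q r t -> convex_on_tet f p' q' r' t'.
Proof. by move=> sub cf x y c /sub tx /sub ty; exact: cf. Qed.

Lemma in_tet_swap p q r t x : in_tet p q r t x -> in_tet q p r t x.
Proof.
move=> [l0 [l1 [l2 [l3 [[? ? ? ?] [l1E ->]]]]]]; exists l1, l0, l2, l3.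
by split; [split|rewrite (addrC l1) (addrC (l1 *: _))].
Qed.

Lemma in_tet_cut p q r t s x : 0 <= s <= 1 ->
  in_tet p ((1 - s) *: p + s *: q) r t x -> in_tet p q r t x.
Proof.
move=> /andP[s0 s1] [l0 [l1 [l2 [l3 [[? ? ? ?] [l1E ->]]]]]].
exists (l0 + l1 * (1 - s)), (l1 * s), l2, l3.
split; first by split=> //; nra.
split; first by rewrite -[RHS]l1E; ring.
by apply/rowP => i; rewrite !mxE; ring.
Qed.

End TetrahedronAverage.

(** * Geometry of the dipyramid *)

Section VectorAlgebra.
Context {R : realType}.
Notation vec := 'rV[R]_3.
Implicit Types (u v w : vec) (a b c : R).

Lemma dotE u v : dot u v = u ord0 (inord 0) * v ord0 (inord 0)
  + u ord0 (inord 1) * v ord0 (inord 1) + u ord0 (inord 2) * v ord0 (inord 2).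
Proof.
rewrite /dot !big_ord_recl big_ord0 addr0 addrA.
by congr (_ * _ + _ * _ + _ * _); congr (fun_of_matrix _ ord0 _); apply: val_inj; rewrite /= inordK.
Qed.

Lemma cross0E u v : cross u v ord0 (inord 0) =
  u ord0 (inord 1) * v ord0 (inord 2) - u ord0 (inord 2) * v ord0 (inord 1).
Proof. by rewrite mxE inordK. Qed.

Lemma cross1E u v : cross u v ord0 (inord 1) =
  u ord0 (inord 2) * v ord0 (inord 0) - u ord0 (inord 0) * v ord0 (inord 2).
Proof. by rewrite mxE inordK. Qed.

Lemma cross2E u v : cross u v ord0 (inord 2) =
  u ord0 (inord 0) * v ord0 (inord 1) - u ord0 (inord 1) * v ord0 (inord 0).
Proof. by rewrite mxE inordK. Qed.

(** Lagrange's identity. *)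
Lemma dot_cross_cross u v :
  dot (cross u v) (cross u v) = dot u u * dot v v - dot u v ^+ 2.
Proof. by rewrite !dotE cross0E cross1E cross2E; ring. Qed.

(** The squared triple product is the Gram determinant. *)
Lemma triple_sqr u v w : dot u (cross v w) ^+ 2 =
  dot u u * (dot v v * dot w w - dot v w ^+ 2)
  - dot u v * (dot u v * dot w w - dot v w * dot u w)
  + dot u w * (dot u v * dot v w - dot v v * dot u w).
Proof. by rewrite !dotE cross0E cross1E cross2E; ring. Qed.

Lemma triple_lincomb (e1 e2 e3 : vec) (a1 a2 a3 b1 b2 b3 c1 c2 c3 : R) :
  dot (a1 *: e1 + a2 *: e2 + a3 *: e3)
    (cross (b1 *: e1 + b2 *: e2 + b3 *: e3) (c1 *: e1 + c2 *: e2 + c3 *: e3)) =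
  (a1 * (b2 * c3 - b3 * c2) - a2 * (b1 * c3 - b3 * c1) + a3 * (b1 * c2 - b2 * c1))
  * dot e1 (cross e2 e3).
Proof. by rewrite !dotE !cross0E !cross1E !cross2E !mxE; ring. Qed.

Lemma dot_lincomb (e1 e2 e3 : vec) (b1 b2 b3 c1 c2 c3 : R) :
  dot (b1 *: e1 + b2 *: e2 + b3 *: e3) (c1 *: e1 + c2 *: e2 + c3 *: e3) =
  b1 * c1 * dot e1 e1 + b2 * c2 * dot e2 e2 + b3 * c3 * dot e3 e3
  + (b1 * c2 + b2 * c1) * dot e1 e2 + (b1 * c3 + b3 * c1) * dot e1 e3
  + (b2 * c3 + b3 * c2) * dot e2 e3.
Proof. by rewrite !dotE !mxE; ring. Qed.

Lemma tri_area_homothety (o p q r : vec) (c : R) :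
  tri_area (homothety o c p) (homothety o c q) (homothety o c r) = c ^+ 2 * tri_area p q r.
Proof.
have hB x y : homothety o c x - homothety o c y = c *: (x - y).
  by apply/rowP => i; rewrite !mxE; ring.
rewrite /tri_area !hB /vnorm.
have -> : dot (cross (c *: (q - p)) (c *: (r - p))) (cross (c *: (q - p)) (c *: (r - p)))
    = (c ^+ 2) ^+ 2 * dot (cross (q - p) (r - p)) (cross (q - p) (r - p)).
  by rewrite !dot_cross_cross !dotE !mxE; ring.
by rewrite sqrtrM ?sqr_ge0// sqrtr_sqr ger0_norm ?sqr_ge0// mulrA.
Qed.

End VectorAlgebra.

(** * Areas, volumes and angles over a regular polygon *)

Section RegularPolygon.
Context {R : realType}.
Variables (n : nat) (C e1 e2 e3 : 'rV[R]_3) (rad th : R).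
Hypotheses (n3 : (3 <= n)%N) (rad0 : 0 < rad).
Hypotheses (e11 : dot e1 e1 = 1) (e22 : dot e2 e2 = 1) (e33 : dot e3 e3 = 1).
Hypotheses (e12 : dot e1 e2 = 0) (e13 : dot e1 e3 = 0) (e23 : dot e2 e3 = 0).

Let A := reg_vertex n C e1 e2 rad th.
Let apex (a : R) := C + a *: e3.
Let step : R := 2 * pi / n%:R.

(* Twice the area of the projection of a lateral face onto the plane of the polygon. *)
Definition base_area2 : R := rad ^+ 2 * sin step.

(** Twice the area of a lateral face with apex at height [a], by Lagrange's identity: its two
    lateral edges have squared length [rad ^+ 2 + a ^+ 2] and dot product
    [rad ^+ 2 * cos step + a ^+ 2]. *)
Definition face_area2 (a : R) : R :=
  Num.sqrt ((rad ^+ 2 + a ^+ 2) ^+ 2 - (rad ^+ 2 * cos step + a ^+ 2) ^+ 2).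

(** With at least three vertices the central angle [step] is less than [pi]. *)
Lemma base_area2_gt0 : 0 < base_area2.
Proof.
have n0 : 0 < n%:R :> R by rewrite ltr0n; apply: leq_trans n3.
have pi0 := pi_gt0 R.
rewrite /base_area2 mulr_gt0 ?exprn_gt0// sin_gt0_pi//.
apply/andP; split; first by rewrite divr_gt0// mulr_gt0.
rewrite ltr_pdivrMr// mulrC ltr_pM2l// ltr_nat.
exact: n3.
Qed.

Lemma reg_vertex_sub_apex k a : A k - apex a =
  (rad * cos (th + 2 * pi * k%:R / n%:R)) *: e1
  + (rad * sin (th + 2 * pi * k%:R / n%:R)) *: e2 + (- a) *: e3.
Proof. by apply/rowP => i; rewrite !mxE; ring. Qed.

Lemma next_angle k : th + 2 * pi * k.+1%:R / n%:R =
  th + 2 * pi * k%:R / n%:R + step :> R.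
Proof. by rewrite -natr1 /step; ring. Qed.

(** The orientation of the frame is unspecified, so the triple product is known only up to sign. *)
Lemma triple_frame : `|dot e1 (cross e2 e3)| = 1.
Proof.
have : dot e1 (cross e2 e3) ^+ 2 = 1.
  by rewrite triple_sqr e11 e22 e33 e12 e13 e23; ring.
by move/eqP; rewrite sqrf_eq1 => /orP[]/eqP ->; rewrite ?normrN normr1.
Qed.

(** Used twice: [d = b - a] yields the volume of a simplex, [d = 1] the angle between the axis and a
    face. *)
Lemma apex_triple k a d :
  `|dot (d *: e3) (cross (A k - apex a) (A k.+1 - apex a))| = `|d| * base_area2.
Proof.
have -> : d *: e3 = 0 *: e1 + 0 *: e2 + d *: e3 by rewrite !scale0r !add0r.
rewrite !reg_vertex_sub_apex triple_lincomb normrM triple_frame mulr1.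
rewrite -[base_area2]gtr0_norm ?base_area2_gt0// -normrM; congr `|_|.
rewrite next_angle /base_area2; move: (th + _) step => x y.
rewrite sinD cosD -[sin y in RHS]mul1r -(cos2Dsin2 x); ring.
Qed.

Lemma tet_volume_apex k a b :
  tet_volume (apex a) (apex b) (A k) (A k.+1) = `|b - a| * base_area2 / 6.
Proof.
rewrite /tet_volume -(apex_triple k a (b - a)); congr (`|dot _ _| / 6).
by apply/rowP => i; rewrite !mxE; ring.
Qed.

Lemma vnorm_face k a :
  vnorm (cross (A k - apex a) (A k.+1 - apex a)) = face_area2 a.
Proof.
rewrite /vnorm /face_area2 dot_cross_cross !reg_vertex_sub_apex !dot_lincomb.
rewrite e11 e22 e33 e12 e13 e23 next_angle; move: (th + _) step => x y.
rewrite sinD cosD; congr Num.sqrt; have cx := cos2Dsin2 x; have cy := cos2Dsin2 y.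
rewrite [in RHS]expr2; congr (_ * _ - _ ^+ 2).
- by transitivity (rad ^+ 2 * (cos x ^+ 2 + sin x ^+ 2) + a ^+ 2); [ring|rewrite cx mulr1].
- by transitivity (rad ^+ 2 * ((cos x ^+ 2 + sin x ^+ 2) * (cos y ^+ 2 + sin y ^+ 2)) + a ^+ 2);
    [ring|rewrite cx cy !mulr1].
- by transitivity (rad ^+ 2 * (cos y * (cos x ^+ 2 + sin x ^+ 2)) + a ^+ 2);
    [ring|rewrite cx mulr1].
Qed.

Lemma tri_area_apex k a : tri_area (apex a) (A k) (A k.+1) = face_area2 a / 2.
Proof. by rewrite /tri_area vnorm_face. Qed.

(** Projection does not increase area; the squares differ by
    [2 * a ^+ 2 * rad ^+ 2 * (1 - cos step)]. *)
Lemma base_area2_le a : base_area2 <= face_area2 a.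
Proof.
have b0 := base_area2_gt0.
rewrite -(ger0_norm (ltW b0)) -sqrtr_sqr ler_wsqrtr// /base_area2 exprMn.
have -> : sin step ^+ 2 = 1 - cos step ^+ 2 by rewrite -(cos2Dsin2 step); ring.
have := mulr_ge0 (mulr_ge0 (sqr_ge0 a) (sqr_ge0 rad)) (_ : 0 <= 1 - cos step).
by rewrite subr_ge0 => /(_ (cos_le1 _)); lra.
Qed.

Lemma face_area2_gt0 a : 0 < face_area2 a.
Proof. exact: lt_le_trans base_area2_gt0 (base_area2_le a). Qed.

Lemma sin_line_plane_angle a :
  sin (line_plane_angle e3 (apex a) (A 0%N) (A 1%N)) = base_area2 / face_area2 a.
Proof.
rewrite /line_plane_angle vnorm_face.
have := apex_triple 0 a 1; rewrite scale1r normr1 mul1r => ->.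
rewrite /vnorm e33 sqrtr1 mul1r asinK// in_itv/=; apply/andP; split.
  apply: (@le_trans _ _ 0); first by lra.
  by rewrite divr_ge0// ltW// ?base_area2_gt0 ?face_area2_gt0.
by rewrite ler_pdivrMr ?face_area2_gt0// mul1r base_area2_le.
Qed.

End RegularPolygon.

(** * Means over the sides *)

Section Means.
Context {R : realType}.
Implicit Types (n : nat) (g h : nat -> R) (f : 'rV[R]_3 -> R) (A : nat -> 'rV[R]_3).

Definition mean n g := (\sum_(k <- iota 0 n) g k) / n%:R.

Lemma mean_le n g h : (forall k, (k < n)%N -> g k <= h k) -> mean n g <= mean n h.
Proof.
move=> gh; rewrite /mean ler_wpM2r ?invr_ge0// big_seq [leRHS]big_seq ler_sum// => k.
by rewrite mem_iota add0n => /andP[_ /gh].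
Qed.

Lemma meanD n g h : mean n (fun k => g k + h k) = mean n g + mean n h.
Proof. by rewrite /mean big_split mulrDl. Qed.

Lemma meanZ n c g : mean n (fun k => c * g k) = c * mean n g.
Proof. by rewrite /mean -big_distrr mulrA. Qed.

Lemma mean_cst n c : (0 < n)%N -> mean n (fun=> c) = c.
Proof.
move=> n0; rewrite /mean big_const_seq count_predT size_iota iter_addr_0.
by rewrite -(mulr_natr c) mulfK// pnatr_eq0 -lt0n.
Qed.

Lemma sum_cst_weight n c g (w : nat -> R) : (forall k, w k = c) -> (0 < n)%N ->
  \sum_(k <- iota 0 n) w k * g k = c * n%:R * mean n g.
Proof.
move=> wc n0; under eq_bigr do rewrite wc.
by rewrite -big_distrr/= -mulrA /mean (mulrC n%:R) divfK// pnatr_eq0 -lt0n.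
Qed.

Lemma sum_cst n c (w : nat -> R) : (forall k, w k = c) ->
  \sum_(k <- iota 0 n) w k = c * n%:R.
Proof.
move=> wc; under eq_bigr do rewrite wc.
by rewrite big_const_seq count_predT size_iota iter_addr_0 -(mulr_natr c).
Qed.

Lemma surf_avg_umbrella n A X f c : (0 < n)%N -> 0 < c ->
  (forall k, tri_area X (A k) (A k.+1) = c) ->
  surf_avg f (umbrella n A X) = mean n (fun k => tri_avg f X (A k) (A k.+1)).
Proof.
move=> n0 c0 H; rewrite /surf_avg !big_map/= (sum_cst_weight _ H)// (sum_cst _ H).
by rewrite mulrAC mulfV ?mul1r// mulf_neq0 ?pnatr_eq0 -?lt0n// gt_eqF.
Qed.

Lemma body_avg_dipyramid n A X Y f c : (0 < n)%N -> 0 < c ->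
  (forall k, tet_volume X Y (A k) (A k.+1) = c) ->
  body_avg f (dipyramid n A X Y) = mean n (fun k => tet_avg f X Y (A k) (A k.+1)).
Proof.
move=> n0 c0 H; rewrite /body_avg !big_map/= (sum_cst_weight _ H)// (sum_cst _ H).
by rewrite mulrAC mulfV ?mul1r// mulf_neq0 ?pnatr_eq0 -?lt0n// gt_eqF.
Qed.

Lemma weighted_mean2 n c d g h (w v : nat -> R) : (0 < n)%N -> 0 < c -> 0 < d ->
  (forall k, w k = c) -> (forall k, v k = d) ->
  (\sum_(k <- iota 0 n) w k * g k + \sum_(k <- iota 0 n) v k * h k) /
  (\sum_(k <- iota 0 n) w k + \sum_(k <- iota 0 n) v k) =
  c / (c + d) * mean n g + d / (c + d) * mean n h.
Proof.
move=> n0 c0 d0 wc vd; rewrite !(sum_cst_weight _ wc, sum_cst_weight _ vd)//.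
rewrite !(sum_cst _ wc, sum_cst _ vd).
move: (mean n _) (mean n _) => a b; field.
by rewrite -mulrDl mulf_eq0 pnatr_eq0 (gtn_eqF n0) orbF gt_eqF ?addr_gt0.
Qed.

Lemma surf_avg_dipyramid_boundary n A X Y f c d : (0 < n)%N -> 0 < c -> 0 < d ->
  (forall k, tri_area X (A k) (A k.+1) = c) ->
  (forall k, tri_area Y (A k) (A k.+1) = d) ->
  surf_avg f (dipyramid_boundary n A X Y) =
  c / (c + d) * mean n (fun k => tri_avg f X (A k) (A k.+1)) +
  d / (c + d) * mean n (fun k => tri_avg f Y (A k) (A k.+1)).
Proof.
move=> n0 c0 d0 Hc Hd; rewrite /surf_avg !big_cat !big_map/=.
exact: (@weighted_mean2 n c d _ _ (fun k => tri_area X (A k) (A k.+1))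
  (fun k => tri_area Y (A k) (A k.+1))).
Qed.

Lemma convex_comb_le (s a u v x y : R) : 0 <= s <= 1 ->
  x <= 1 / 4 * a + 3 / 4 * u -> y <= 1 / 4 * a + 3 / 4 * v ->
  s * x + (1 - s) * y <= 1 / 4 * a + 3 / 4 * (s * u + (1 - s) * v).
Proof. by move=> /andP[s0 s1] hx hy; nra. Qed.

(* The weights sin eta1 / (sin eta0 + sin eta1) are area weights because
   sin eta_i is inversely proportional to the area of a side of the i-th umbrella. *)
Lemma area_weight (K a b : R) : 0 < K -> 0 < a -> 0 < b ->
  K / b / (K / a + K / b) =
  (3 / 4) ^+ 2 * (a / 2) / ((3 / 4) ^+ 2 * (a / 2) + (3 / 4) ^+ 2 * (b / 2)).
Proof.
move=> K0 a0 b0; have Ka := mulr_gt0 K0 a0; have Kb := mulr_gt0 K0 b0.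
by field; apply/and4P; split; apply: lt0r_neq0; lra.
Qed.

End Means.

(** * The three inequalities for the dipyramid *)

Theorem theorem7p2 (R : realType) (n : nat) (C e1 e2 e3 : 'rV[R]_3)
    (rad th a0 a1 : R) (f : 'rV[R]_3 -> R) :
  (3 <= n)%N ->
  0 < rad ->
  dot e1 e1 = 1 -> dot e2 e2 = 1 -> dot e3 e3 = 1 ->
  dot e1 e2 = 0 -> dot e1 e3 = 0 -> dot e2 e3 = 0 ->
  a0 != 0 -> a1 != 0 -> a0 != a1 ->
  let A := reg_vertex n C e1 e2 rad th in
  let O0 := C + a0 *: e3 in
  let O1 := C + a1 *: e3 in
  (forall k, (k < n)%N -> convex_on_tet f O0 O1 (A k) (A k.+1)) ->
  let eta0 := line_plane_angle e3 O0 (A 0%N) (A 1%N) in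
  let eta1 := line_plane_angle e3 O1 (A 0%N) (A 1%N) in
  forall s : R, 0 < s < 1 ->
  let Os := (1 - s) *: O0 + s *: O1 in
  let h := homothety Os (3 / 4) in
  let hA := fun k => h (A k) in
  [/\ body_avg f (dipyramid n A O0 O1)
        <= 1 / 4 * f Os
           + 3 / 4 * (s * surf_avg f (umbrella n A O0)
                      + (1 - s) * surf_avg f (umbrella n A O1)),
      s * surf_avg f (umbrella n hA (h O0))
        + (1 - s) * surf_avg f (umbrella n hA (h O1))
        <= body_avg f (dipyramid n A O0 O1)
    & surf_avg f (dipyramid_boundary n hA (h O0) (h O1))
        <= sin eta1 / (sin eta0 + sin eta1) * body_avg f (dipyramid n A O0 Os)
           + sin eta0 / (sin eta0 + sin eta1) * body_avg f (dipyramid n A O1 Os)].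
Proof.
move=> n3 rad0 e11 e22 e33 e12 e13 e23 a00 a10 a01 A O0 O1 cf eta0 eta1 s s01 Os h hA.
have n0 : (0 < n)%N by exact: leq_trans n3.
have /andP[s0 s1] := s01.
have s01' : 0 <= s <= 1 by rewrite !ltW.
have OsE : Os = C + ((1 - s) * a0 + s * a1) *: e3.
  by apply/rowP => i; rewrite !mxE; ring.
have b0 : 0 < base_area2 n rad by exact: base_area2_gt0.
have N0 (a : R) : 0 < face_area2 n rad a by exact: face_area2_gt0.
have area (a : R) k : tri_area (C + a *: e3) (A k) (A k.+1) = face_area2 n rad a / 2.
  exact: tri_area_apex.
have harea (a : R) k : tri_area (h (C + a *: e3)) (hA k) (hA k.+1) =
    (3 / 4) ^+ 2 * (face_area2 n rad a / 2).
  by rewrite tri_area_homothety area.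
have area0 (a : R) : 0 < face_area2 n rad a / 2 by rewrite divr_gt0.
have harea0 (a : R) : 0 < (3 / 4) ^+ 2 * (face_area2 n rad a / 2) by rewrite mulr_gt0// exprn_gt0.
have volume (a b : R) k : tet_volume (C + a *: e3) (C + b *: e3) (A k) (A k.+1) =
    `|b - a| * base_area2 n rad / 6.
  exact: tet_volume_apex.
have volume0 (a b : R) : a != b -> 0 < `|b - a| * base_area2 n rad / 6.
  move=> ab; apply: divr_gt0 => //; apply: mulr_gt0 => //.
  by rewrite normr_gt0 subr_eq0 eq_sym.
have body (a b : R) : a != b ->
    body_avg f (dipyramid n A (C + a *: e3) (C + b *: e3)) =
    mean n (fun k => tet_avg f (C + a *: e3) (C + b *: e3) (A k) (A k.+1)).
  by move=> ab; apply: body_avg_dipyramid (volume a b) => //; exact: volume0.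
have cf0 k : (k < n)%N -> convex_on_tet f O0 Os (A k) (A k.+1).
  by move=> /cf; apply: convex_on_tet_sub => x; exact: in_tet_cut.
have cf1 k : (k < n)%N -> convex_on_tet f O1 Os (A k) (A k.+1).
  move=> /cf; apply: convex_on_tet_sub => x; rewrite /Os.
  (* Seen from [O1], the point [Os] divides the axis with parameter [1 - s]. *)
  rewrite (_ : (1 - s) *: O0 + s *: O1 = (1 - (1 - s)) *: O1 + (1 - s) *: O0).
    by move=> H; apply: in_tet_swap; apply: in_tet_cut H; lra.
  by rewrite addrC; congr (_ *: _ + _); lra.
split.
- rewrite body// (surf_avg_umbrella _ n0 (area0 a0) (area a0)).
  rewrite (surf_avg_umbrella _ n0 (area0 a1) (area a1)) -!meanZ -meanD -meanZ.
  rewrite -(mean_cst (1 / 4 * f Os) n0) -meanD; apply: mean_le => k kn.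
  rewrite (tet_avg_split (cf k kn) s01').
  exact: (convex_comb_le s01' (tet_avg_le (cf0 k kn)) (tet_avg_le (cf1 k kn))).
- rewrite body// (surf_avg_umbrella _ n0 (harea0 a0) (harea a0)).
  rewrite (surf_avg_umbrella _ n0 (harea0 a1) (harea a1)) -!meanZ -meanD.
  apply: mean_le => k kn; rewrite (tet_avg_split (cf k kn) s01').
  apply: lerD; apply: ler_wpM2l; [exact: ltW|exact: tet_avg_ge (cf0 k kn)| |].
    by rewrite subr_ge0 ltW.
  exact: tet_avg_ge (cf1 k kn).
- rewrite (surf_avg_dipyramid_boundary _ n0 (harea0 a0) (harea0 a1) (harea a0) (harea a1)).
  rewrite /eta0 /eta1 !sin_line_plane_angle//.
  (* [Os] differs from [O0] and [O1], so both smaller dipyramids have positive volume and their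
     averages are genuine means. *)
  have sa0 : a0 != (1 - s) * a0 + s * a1.
    apply: contra a01 => /eqP H; apply/eqP.
    have : s * (a0 - a1) = 0 by lra.
    by move/eqP; rewrite mulf_eq0 subr_eq0 gt_eqF//= => /eqP.
  have sa1 : a1 != (1 - s) * a0 + s * a1.
    apply: contra a01 => /eqP H; apply/eqP.
    have : (1 - s) * (a0 - a1) = 0 by lra.
    by move/eqP; rewrite mulf_eq0 !subr_eq0 gt_eqF//= => /eqP.
  have bodyOs0 : body_avg f (dipyramid n A O0 Os) =
      mean n (fun k => tet_avg f O0 Os (A k) (A k.+1)) by rewrite OsE; exact: body.
  have bodyOs1 : body_avg f (dipyramid n A O1 Os) =
      mean n (fun k => tet_avg f O1 Os (A k) (A k.+1)) by rewrite OsE; exact: body.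
  rewrite bodyOs0 bodyOs1.
  (* The sine weights become the area shares of the two shrunken umbrellas, and each umbrella is
     compared with the half on its own side of [Os]. *)
  rewrite (area_weight b0 (N0 a0) (N0 a1)) (addrC (_ / face_area2 _ _ a0)).
  rewrite (area_weight b0 (N0 a1) (N0 a0)) (addrC (_ * (face_area2 _ _ a1 / 2))).
  have w0 : 0 <= (3 / 4) ^+ 2 * (face_area2 n rad a0 / 2) /
      ((3 / 4) ^+ 2 * (face_area2 n rad a0 / 2) + (3 / 4) ^+ 2 * (face_area2 n rad a1 / 2)).
    by rewrite divr_ge0// ltW// addr_gt0.
  have w1 : 0 <= (3 / 4) ^+ 2 * (face_area2 n rad a1 / 2) /
      ((3 / 4) ^+ 2 * (face_area2 n rad a0 / 2) + (3 / 4) ^+ 2 * (face_area2 n rad a1 / 2)).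
    by rewrite divr_ge0// ltW// addr_gt0.
  apply: lerD; apply: ler_wpM2l; [exact: w0| |exact: w1|]; apply: mean_le => k kn.
    exact: tet_avg_ge (cf0 k kn).
  exact: tet_avg_ge (cf1 k kn).
Qed.
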